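(* Let $n\ge 2$, $d\ge 1$, let $\mathbf r=(r_1,\dots,r_n)^T$ be a strictly positive stochastic vector, and let the random process $\{\mathbf x_i(t)\}_{t\ge 1}$, $i\in[n]$, be generated by the dynamics $$\mathbf x_i(t+1)=(1-\beta(t))\,\mathbf x_i(t)+\beta(t)\,\hat{\mathbf x}_i(t)-\alpha(t)\,\mathbf g_i(\mathbf x_i(t)),\qquad \hat{\mathbf x}_i(t)=\sum_{j=1}^n W_{ij}(t)\,\mathbf x_j(t)+\mathbf e_i(t),\qquad t\ge 1,$$ with the objects described in the context. Suppose the Noise, Connectivity, Objective Function and Step-size Assumptions listed in the context all hold. Then there is a (random) point $\tilde{\mathbf x}$ such that, almost surely, $\tilde{\mathbf x}\in\mathcal X^\star$ and $\lim_{t\to\infty}\mathbf x_i(t)=\tilde{\mathbf x}$ for all $i\in[n]$, where $\mathcal X^\star=\arg\min_{\mathbf x\in\mathbb R^d}\sum_{i=1}^n r_i f_i(\mathbf x)$.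
   Context: Notation: $[n]=\{1,\dots,n\}$; $\|\cdot\|$ is the Euclidean norm on $\mathbb R^d$; $\mathbf 1\in\mathbb R^n$ is the all-one column vector; for a real sequence $\{a(t)\}$, $\Delta a(t):=a(t+1)-a(t)$. A stochastic vector has nonnegative entries summing to $1$. Setting: there are $n\ge 2$ agents. For each $t\ge1$, $\mathcal G(t)=([n],\mathcal E(t))$ is a directed graph with $\mathcal E(t)\subseteq[n]\times[n]$, and $W(t)=[W_{ij}(t)]$ is a (deterministic) row-stochastic $n\times n$ matrix with $W_{ij}(t)>0$ if and only if $(j,i)\in\mathcal E(t)$. Each agent $i$ has a local cost function $f_i:\mathbb R^d\to\mathbb R$, and $\mathbf g_i(\mathbf x)$ denotes a subgradient of $f_i$ at $\mathbf x$. The $\mathbf e_i(t)$ are random noise vectors in $\mathbb R^d$. The initial vectors $\mathbf x_i(1)\in\mathbb R^d$ are arbitrary and deterministic. $X(t)$ is the $n\times d$ matrix with rows $\mathbf x_1(t),\dots,\mathbf x_n(t)$, and $\{\mathcal F_t\}$ is the natural filtration of the random process $\{X(t)\}$. $\{\alpha(t)\}$ and $\{\beta(t)\}$ are deterministic real step-size sequences. Noise Assumption: there is $\gamma>0$ such that $\mathbb E[\mathbf e_i(t)\mid\mathcal F_t]=0$ and $\mathbb E[\|\mathbf e_i(t)\|^2\mid\mathcal F_t]\le\gamma$ for all $i\in[n]$ and $t\ge1$. Connectivity Assumption: (a) $W(t)$ is nonnegative, $W(t)\mathbf 1=\mathbf 1$ and $\mathbf r^TW(t)=\mathbf r^T$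 for all $t\ge1$, where $\mathbf r>0$ is the given stochastic weight vector. (b) There is $\eta>0$ such that whenever $W_{ij}(t)>0$ (for $i,j\in[n]$, $t\ge1$), then $W_{ij}(t)\ge\eta$. (c) There is an integer $B\ge1$ such that the graph $\big([n],\bigcup_{k=t+1}^{t+B}\mathcal E(k)\big)$ is strongly connected for all $t\ge1$. Objective Function Assumption: (a) each $f_i$ is convex; (b) $\mathcal X^\star=\arg\min_{\mathbf x\in\mathbb R^d}\sum_{i=1}^n r_if_i(\mathbf x)$ is non-empty; (c) there is $L>0$ such that $\|\mathbf g\|<L$ for every $i$, every $\mathbf x\in\mathbb R^d$ and every subgradient $\mathbf g$ of $f_i$ at $\mathbf x$. Step-size Assumption: $\{\alpha(t)\}$ and $\{\beta(t)\}$ are non-increasing, $\alpha(t)>0$ and $0<\beta(t)\le1$ for all $t\ge1$, and (a) $\sum_{t=1}^\infty\alpha(t)=\infty$; (b) $\sum_{t=1}^\infty\alpha^2(t)<\infty$ and $\sum_{t=1}^\infty\beta^2(t)<\infty$; (c) $\sum_{t=1}^\infty\frac{\alpha^2(t)}{\beta(t)}<\infty$; and there are $t_0\ge1$ and positive constants $c_1<\frac{\lambda}{2}$, $c_2<\frac{\lambda}{4}$ such that for every $t\ge t_0$ (d) $-\Delta\beta(t)\le c_1\beta^2(t)$; (e) $-\Delta\alpha(t)\le c_2\,\alpha(t)\beta(t)$, where $\lambda:=\frac{\eta\, r_{\min}}{2Bn^2}$, $r_{\min}:=\min_{i\in[n]}r_i$, and $\eta,B$ are the constants of the Connectivity Assumption.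 *)

(* Defs.v *)
From HB Require Import structures.
From mathcomp Require Import all_boot all_order all_algebra.
From mathcomp Require Import all_classical all_reals all_analysis.

Set Implicit Arguments.
Unset Strict Implicit.
Unset Printing Implicit Defensive.

Import Order.TTheory GRing.Theory Num.Theory.
Import numFieldNormedType.Exports.

Local Open Scope classical_set_scope.
Local Open Scope ring_scope.

(* The library's norm on 'rV[R]_d is the sup norm, hence the Euclidean one is defined here. *)
Definition dotv (R : realType) (d : nat) (u v : 'rV[R]_d) : R :=
  \sum_(j < d) u 0 j * v 0 j.

Definition enorm (R : realType) (d : nat) (u : 'rV[R]_d) : R :=
  Num.sqrt (dotv u u).

Definition subgradient (R : realType) (d : nat) (f : 'rV[R]_d -> R)
    (x g : 'rV[R]_d) : Prop :=
  forall y : 'rV[R]_d, f x + dotv g (y - x) <= f y.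

Definition argmin (R : realType) (U : Type) (F : U -> R) : set U :=
  [set x | forall y, F x <= F y].

Definition strongly_connected (V : finType) (A : {set V * V}) : Prop :=
  forall u v : V, connect (fun a b => (a, b) \in A) u v.

Definition Delta (R : realType) (a : nat -> R) (t : nat) : R := a t.+1 - a t.

Section probabilistic_notions.
Context {disp : measure_display} {T : measurableType disp} {R : realType}.

Definition random_vector (d : nat) (X : T -> 'rV[R]_d) : Prop :=
  forall j : 'I_d, measurable_fun setT (fun w => X w 0 j).

(* The sigma-algebra generated by the entries of X(1), ..., X(t). *)
Definition natural_filtration (n d : nat) (X : nat -> T -> 'M[R]_(n, d))
    (t : nat) : set (set T) :=
  <<s [set A | exists s i j, (1 <= s <= t)%N /\
         preimage_set_system setT (fun w => X s w i j) measurable A] >>.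

(* Y is a version of the conditional expectation E[X | G], for a
   sub-sigma-algebra G. *)
Record is_cond_exp (P : probability T R) (G : set (set T)) (X Y : T -> R) :
    Prop := {
  cond_exp_integrable : P.-integrable setT (EFin \o X) ;
  cond_exp_version_integrable : P.-integrable setT (EFin \o Y) ;
  cond_exp_measurable : forall B : set R, measurable B -> G (Y @^-1` B) ;
  cond_exp_integral : forall A : set T, G A ->
    (\int[P]_(w in A) (Y w)%:E = \int[P]_(w in A) (X w)%:E)%E }.

(* Time starts at 1 throughout: values of processes and sequences at index 0
   are irrelevant. *)
Record noise_assumption (n d : nat) (P : probability T R)
    (F : nat -> set (set T)) (e : nat -> 'I_n -> T -> 'rV[R]_d) (gamma : R) :
    Prop := {
  noise_gamma_gt0 : 0 < gamma ;
  noise_mean0 : forall t i, (1 <= t)%N -> forall j : 'I_d,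
    is_cond_exp P (F t) (fun w => e t i w 0 j) (cst 0) ;
  noise_var : forall t i, (1 <= t)%N -> exists2 Y : T -> R,
    is_cond_exp P (F t) (fun w => enorm (e t i w) ^+ 2) Y &
    {ae P, forall w, Y w <= gamma} }.

End probabilistic_notions.

Section deterministic_assumptions.
Context {R : realType}.

Record stochastic_pos (n : nat) (r : 'cV[R]_n) : Prop := {
  stochastic_gt0 : forall i, 0 < r i 0 ;
  stochastic_sum1 : \sum_(i < n) r i 0 = 1 }.

Record connectivity_assumption (n : nat) (r : 'cV[R]_n)
    (E : nat -> {set 'I_n * 'I_n}) (W : nat -> 'M[R]_n) (eta : R) (B : nat) :
    Prop := {
  conn_W_ge0 : forall t i j, (1 <= t)%N -> 0 <= W t i j ;
  conn_W_row : forall t, (1 <= t)%N ->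
    W t *m const_mx 1 = const_mx 1 :> 'cV[R]_n ;
  conn_W_r : forall t, (1 <= t)%N -> r^T *m W t = r^T ;
  conn_eta_gt0 : 0 < eta ;
  conn_eta : forall t i j, (1 <= t)%N -> 0 < W t i j -> eta <= W t i j ;
  conn_B_gt0 : (1 <= B)%N ;
  conn_strong : forall t, (1 <= t)%N ->
    strongly_connected (\bigcup_(t.+1 <= k < (t + B).+1) E k)%SET }.

Definition wobjective (n d : nat) (r : 'cV[R]_n) (f : 'I_n -> 'rV[R]_d -> R)
    (x : 'rV[R]_d) : R :=
  \sum_(i < n) r i 0 * f i x.

Record objective_assumption (n d : nat) (r : 'cV[R]_n)
    (f : 'I_n -> 'rV[R]_d -> R) (L : R) : Prop := {
  obj_convex : forall i, @convex_function R 'rV[R]_d setT (f i) ;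
  obj_argmin : argmin (wobjective r f) !=set0 ;
  obj_L_gt0 : 0 < L ;
  obj_L : forall i x g, subgradient (f i) x g -> enorm g < L }.

(* The default 1 of the iterated minimum is harmless: the entries of a
   stochastic vector are at most 1. *)
Definition rmin (n : nat) (r : 'cV[R]_n) : R :=
  \big[Num.min/1]_(i < n) r i 0.

Definition lambda (n : nat) (r : 'cV[R]_n) (eta : R) (B : nat) : R :=
  eta * rmin r / (2 * B%:R * n%:R ^+ 2).

Record stepsize_assumption (alpha beta : nat -> R) (lam : R) : Prop := {
  step_alpha_noninc : forall s t, (1 <= s <= t)%N -> alpha t <= alpha s ;
  step_beta_noninc : forall s t, (1 <= s <= t)%N -> beta t <= beta s ;
  step_alpha_gt0 : forall t, (1 <= t)%N -> 0 < alpha t ;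
  step_beta_01 : forall t, (1 <= t)%N -> 0 < beta t <= 1 ;
  step_sum_alpha : (\sum_(1 <= t <oo) (alpha t)%:E = +oo)%E ;
  step_sum_alpha2 : (\sum_(1 <= t <oo) (alpha t ^+ 2)%:E < +oo)%E ;
  step_sum_beta2 : (\sum_(1 <= t <oo) (beta t ^+ 2)%:E < +oo)%E ;
  step_sum_alpha2_beta :
    (\sum_(1 <= t <oo) (alpha t ^+ 2 / beta t)%:E < +oo)%E ;
  step_Delta : exists (t0 : nat) (c1 c2 : R),
    [/\ (1 <= t0)%N, 0 < c1 < lam / 2, 0 < c2 < lam / 4 &
      forall t, (t0 <= t)%N ->
        - Delta beta t <= c1 * beta t ^+ 2 /\
        - Delta alpha t <= c2 * alpha t * beta t] }.

End deterministic_assumptions.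

(* Main.v *)
Require Import Defs.
From HB Require Import structures.
From mathcomp Require Import all_boot all_order all_algebra.
From mathcomp Require Import all_classical all_reals all_analysis.
From mathcomp Require Import measurable_realfun ring lra.

Set Implicit Arguments.
Unset Strict Implicit.
Unset Printing Implicit Defensive.

Import Order.TTheory GRing.Theory Num.Theory.
Import numFieldNormedType.Exports.

Local Open Scope classical_set_scope.
Local Open Scope ring_scope.

(** Fix a minimizer [z] of the weighted objective [F] and follow the weighted
    square distance [lyap r z x], the sum of the [r i * |x i - z|^2], along the
    dynamics; write [a] and [b] for the current step sizes.

    One step ([one_step_le]) has three effects.  Averaging with a row-stochastic
    matrix that preserves the weights [r] loses exactly a variance
    ([variance_identity]), hence at least a multiple of [b] times the square
    disagreement across the edges present at that time ([mix_contraction]).  The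
    subgradients push towards [z], by at least [2 a (F (x i0) - F z)] for any
    fixed agent [i0], up to a term in [a^2 / b] and a small multiple of [b]
    times the total disagreement [disag] ([descent_ge]).  The noise adds a term
    that is orthogonal to the past ([noise_orthogonal]) and a term of order
    [b^2].

    Over a window in which the union of the graphs is strongly connected, the
    total disagreement is bounded by the disagreements across the edges and by
    the movements of the agents ([window_disag_le]).  Summing the expectations
    and absorbing ([window_absorption]) shows that the sum of [b * E disag] is
    finite ([weighted_disag_sums]); no product of mixing matrices is estimated.
    From then on every error in the drift of [lyap r z] is summable in
    expectation.  So [lyap r z] is a nonnegative supermartingale up to a
    summable error, and converges almost surely by Doob's upcrossing argument
    ([almost_supermartingale_cvg]); moreover the sums of [a * (F (x i0) - F z)]
    and of [b * disag] are almost surely finite ([ae_bounded_sums]).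

    The end is a statement on single paths ([pathwise_limit]).  Since the sum of
    [a] diverges while those of [a * (F (x i0) - F z)], [b * disag] and
    [a^2 / b] converge, there are arbitrarily late times at which the agents
    are nearly optimal and nearly in agreement ([frequently_optimal]).  A
    cluster point of the states at these times is a minimizer [p].  The distance
    to a minimizer close to [p] converges, and it is small at some of these
    times, so it stays small, and the whole path converges to [p].  A countable
    dense set of minimizers ([countable_dense]) is used here, so that only
    countably many null sets are discarded.

    The selection [g] of subgradients is arbitrary, so that [g i (x t i)] need
    not be measurable for the past up to time [t].  For this reason the noise is
    paired only with the averaged state, its product with the subgradients being
    bounded by squares, and the supermartingale argument is applied only to
    [lyap r z], which is a function of the state. *)

(** * Quadratic inequalities *)

Section quadratic_inequalities.
Context {R : realType} {d : nat}.
Implicit Types u v w : 'rV[R]_d.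

Definition sqn u : R := dotv u u.

Lemma dotvC u v : dotv u v = dotv v u.
Proof. by apply: eq_bigr => j _; rewrite mulrC. Qed.

Lemma dotvDl u v w : dotv (u + v) w = dotv u w + dotv v w.
Proof. by rewrite -big_split; apply: eq_bigr => j _; rewrite mxE mulrDl. Qed.

Lemma dotvZl a u w : dotv (a *: u) w = a * dotv u w.
Proof. by rewrite /dotv big_distrr; apply: eq_bigr => j _; rewrite /= mxE mulrA. Qed.

Lemma dotvNl u w : dotv (- u) w = - dotv u w.
Proof. by rewrite -scaleN1r dotvZl mulN1r. Qed.

Lemma dotvBl u v w : dotv (u - v) w = dotv u w - dotv v w.
Proof. by rewrite dotvDl dotvNl. Qed.

Lemma dotvDr u v w : dotv w (u + v) = dotv w u + dotv w v.
Proof. by rewrite dotvC dotvDl !(dotvC w). Qed.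

Lemma dotvZr a u w : dotv w (a *: u) = a * dotv w u.
Proof. by rewrite dotvC dotvZl (dotvC w). Qed.

Lemma dotvNr u w : dotv w (- u) = - dotv w u.
Proof. by rewrite dotvC dotvNl (dotvC w). Qed.

Lemma dotvBr u v w : dotv w (u - v) = dotv w u - dotv w v.
Proof. by rewrite dotvDr dotvNr. Qed.

Lemma dotv_suml (I : Type) (s : seq I) (Q : pred I) (F : I -> 'rV[R]_d) w :
  dotv (\sum_(i <- s | Q i) F i) w = \sum_(i <- s | Q i) dotv (F i) w.
Proof.
elim/big_rec2: _ => [|i a b _ <-]; last by rewrite dotvDl.
by rewrite /dotv big1// => j _; rewrite mxE mul0r.
Qed.

Definition dotvE := (dotvDl, dotvDr, dotvBl, dotvBr, dotvNl, dotvNr, dotvZl, dotvZr).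

Lemma sqn_ge0 u : 0 <= sqn u.
Proof. by apply: sumr_ge0 => j _; rewrite -expr2 sqr_ge0. Qed.

Lemma sqnN u : sqn (- u) = sqn u.
Proof. by rewrite /sqn dotvNl dotvNr opprK. Qed.

Lemma sqnC u v : sqn (u - v) = sqn (v - u).
Proof. by rewrite -opprB sqnN. Qed.

Lemma sqnZ a u : sqn (a *: u) = a ^+ 2 * sqn u.
Proof. by rewrite /sqn dotvZl dotvZr mulrA. Qed.

Lemma enorm_sqr u : enorm u ^+ 2 = sqn u.
Proof. by rewrite sqr_sqrtr// sqn_ge0. Qed.

Lemma coord_sqr_le u j : u 0 j ^+ 2 <= sqn u.
Proof.
rewrite /sqn /dotv (bigD1 j)//= expr2 lerDl.
by apply: sumr_ge0 => k _; rewrite -expr2 sqr_ge0.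
Qed.

Lemma sqnD u v : sqn (u + v) = sqn u + 2 * dotv u v + sqn v.
Proof. by rewrite /sqn !dotvE (dotvC v u); ring. Qed.

Lemma young (s : R) u v : 0 < s ->
  2 * dotv u v <= s * sqn u + s^-1 * sqn v.
Proof.
move=> s0; have := sqn_ge0 (s *: u - v).
rewrite sqnD dotvNr sqnN sqnZ dotvZl => h.
rewrite -(ler_pM2l s0) mulrDr (mulrA s s^-1) divff ?gt_eqF// mul1r.
by move: h; rewrite expr2; nra.
Qed.

Lemma sqnD2 u v : sqn (u + v) <= 2 * sqn u + 2 * sqn v.
Proof. by have := @young 1 u v ltr01; rewrite invr1 !mul1r sqnD; lra. Qed.

Lemma sqnD3 u v w : sqn (u + v + w) <= 3 * sqn u + 3 * sqn v + 3 * sqn w.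
Proof.
have := @young 1 u v ltr01; have := @young 1 u w ltr01.
have := @young 1 v w ltr01; rewrite invr1 !mul1r !sqnD !dotvE; lra.
Qed.

(** Cauchy-Schwarz, with the cardinal of the index type as constant. *)
Lemma sqn_sum_le (I : finType) (Q : pred I) (F : I -> 'rV[R]_d) :
  sqn (\sum_(i | Q i) F i) <= #|I|%:R * \sum_(i | Q i) sqn (F i).
Proof.
rewrite /sqn dotv_suml.
have step i : dotv (F i) (\sum_(j | Q j) F j) <=
    \sum_(j | Q j) (2^-1 * sqn (F i) + 2^-1 * sqn (F j)).
  rewrite dotvC dotv_suml; apply: ler_sum => j _.
  by have := @young 1 (F j) (F i) ltr01; rewrite invr1 !mul1r; lra.
apply: le_trans (ler_sum _ (fun i _ => step i)) _.
under eq_bigr do rewrite big_split/= sumr_const -mulr_sumr.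
rewrite big_split/= sumrMnl -mulr_sumr sumr_const -/(sqn _).
rewrite [X in _ <= _ * X](_ : _ = \sum_(i | Q i) sqn (F i))//.
set S := \sum_(i | Q i) _.
have S0 : 0 <= S by apply: sumr_ge0 => i _; exact: sqn_ge0.
have qI : (#|Q|%:R : R) <= #|I|%:R by rewrite ler_nat max_card.
rewrite -mulrnDl -[X in X <= _]mulr_natl.
have -> : 2^-1 * S + 2^-1 * S = S by lra.
exact: ler_wpM2r.
Qed.

(** The bias-variance identity: averaging loses exactly the variance.  This
    loss is the only source of contraction in the whole argument. *)
Lemma variance_identity (I : finType) (a : I -> R) (v : I -> 'rV[R]_d) :
  \sum_i a i = 1 ->
  \sum_i a i * sqn (v i) =
  sqn (\sum_i a i *: v i) + \sum_i a i * sqn (v i - \sum_j a j *: v j).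
Proof.
move=> a1; set y := \sum_j a j *: v j.
have yE w : dotv y w = \sum_i a i * dotv (v i) w.
  by rewrite /y dotv_suml; apply: eq_bigr => i _; rewrite dotvZl.
under [X in _ = _ + X]eq_bigr => i _.
  have -> : a i * sqn (v i - y) =
      a i * sqn (v i) - 2 * (a i * dotv (v i) y) + a i * sqn y.
    by rewrite /sqn !dotvE (dotvC y (v i)); ring.
  over.
rewrite big_split sumrB/= -mulr_sumr -mulr_suml -yE a1 mul1r /sqn; lra.
Qed.

Lemma jensen_sqn (I : finType) (a : I -> R) (v : I -> 'rV[R]_d) :
  (forall i, 0 <= a i) -> \sum_i a i = 1 ->
  sqn (\sum_i a i *: v i) <= \sum_i a i * sqn (v i).
Proof.
move=> a0 a1; rewrite (variance_identity _ a1) lerDl.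
by apply: sumr_ge0 => i _; rewrite mulr_ge0// sqn_ge0.
Qed.

(** Two atoms of mass at least [k] at different places force a variance of at
    least [k/2] times their squared distance; averaging over the atoms [j]
    costs the factor [#|I|]. *)
Lemma variance_ge (I : finType) (a : I -> R) (v : I -> 'rV[R]_d) (y : 'rV[R]_d)
    (k : R) (i : I) (Q : pred I) :
  (forall i, 0 <= a i) -> 0 <= k -> k <= a i ->
  (forall j, Q j -> k <= a j) ->
  k / 2 * \sum_(j | Q j) sqn (v i - v j) <=
  #|I|%:R * \sum_j a j * sqn (v j - y).
Proof.
move=> a0 k0 ki kj; set S := \sum_j a j * _.
have t0 j : 0 <= a j * sqn (v j - y) by rewrite mulr_ge0// sqn_ge0.
have S0 : 0 <= S by exact: sumr_ge0.
rewrite mulr_sumr.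
apply: (@le_trans _ _ (\sum_(j | Q j) S)); last first.
  by rewrite sumr_const -[X in X <= _]mulr_natl ler_wpM2r// ler_nat max_card.
apply: ler_sum => j Qj.
have [<-|ij] := eqVneq i j.
  by rewrite subrr /sqn /dotv big1 ?mulr0// => l _; rewrite mxE mul0r.
have : a i * sqn (v i - y) + a j * sqn (v j - y) <= S.
  rewrite /S (bigD1 i)//= (bigD1 j)/= 1?eq_sym// addrA lerDl.
  exact: sumr_ge0.
have := sqnD2 (v i - y) (y - v j); rewrite addrA subrK (sqnC y).
have := kj _ Qj; have := sqn_ge0 (v i - y); have := sqn_ge0 (v j - y).
nra.
Qed.

End quadratic_inequalities.

(** * One step of the dynamics *)

Section one_step.
Context {R : realType} {n d : nat}.
Implicit Types (x e g : 'I_n -> 'rV[R]_d) (z : 'rV[R]_d) (r : 'cV[R]_n)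
  (W : 'M[R]_n) (E : {set 'I_n * 'I_n}) (a b : R).

Definition lyap r z x : R := \sum_i r i 0 * sqn (x i - z).

Definition disag x : R := \sum_i \sum_j sqn (x i - x j).

Definition edge_disag E x : R :=
  \sum_i \sum_(j | (j, i) \in E) sqn (x i - x j).

Definition mix W b x (i : 'I_n) : 'rV[R]_d :=
  x i + b *: (\sum_j W i j *: x j - x i).

Lemma disag_ge0 x : 0 <= disag x.
Proof. by do 2![apply: sumr_ge0 => ? _]; exact: sqn_ge0. Qed.

Lemma edge_disag_ge0 E x : 0 <= edge_disag E x.
Proof. by do 2![apply: sumr_ge0 => ? _]; exact: sqn_ge0. Qed.

Lemma row_disag_le x i : \sum_j sqn (x i - x j) <= disag x.
Proof.
rewrite /disag [leRHS](bigD1 i)//= lerDl.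
by do 2![apply: sumr_ge0 => ? _]; exact: sqn_ge0.
Qed.

Lemma pair_disag_le x i j : sqn (x i - x j) <= disag x.
Proof.
apply: le_trans (row_disag_le x i); rewrite (bigD1 j)//= lerDl.
by apply: sumr_ge0 => ? _; exact: sqn_ge0.
Qed.

Lemma lyap_ge0 r z x : (forall i, 0 <= r i 0) -> 0 <= lyap r z x.
Proof. by move=> r0; apply: sumr_ge0 => i _; rewrite mulr_ge0// sqn_ge0. Qed.

Context (r : 'cV[R]_n) (W : 'M[R]_n) (E : {set 'I_n * 'I_n}).
Hypothesis r_ge0 : forall i, 0 <= r i 0.
Hypothesis r_sum1 : \sum_i r i 0 = 1.
Hypothesis W_ge0 : forall i j, 0 <= W i j.
Hypothesis W_sum1 : forall i, \sum_j W i j = 1.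

Let W_le1 i j : W i j <= 1.
Proof. by rewrite -(W_sum1 i) (bigD1 j)//= lerDl sumr_ge0. Qed.

Let r_le1 i : r i 0 <= 1.
Proof. by rewrite -r_sum1 (bigD1 i)//= lerDl sumr_ge0. Qed.

Let wsum_le (F : 'I_n -> R) : (forall i, 0 <= F i) ->
  \sum_i r i 0 * F i <= \sum_i F i.
Proof. by move=> F0; apply: ler_sum => i _; rewrite ler_piMl. Qed.

Lemma drift_sqn_le x i :
  sqn (\sum_j W i j *: x j - x i) <= \sum_j sqn (x i - x j).
Proof.
have -> : \sum_j W i j *: x j - x i = \sum_j W i j *: (x j - x i).
  under [RHS]eq_bigr do rewrite scalerBr.
  by rewrite sumrB -scaler_suml W_sum1 scale1r.
apply: le_trans (jensen_sqn _ _ _) _ => //.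
by apply: ler_sum => j _; rewrite sqnC ler_piMl// sqn_ge0.
Qed.

(** The step [mix] averages with the matrix [(1 - b) 1 + b W], whose diagonal
    entries and whose entries at the edges are at least [b * eta]; the variance
    lost in each row is then bounded below by [variance_ge]. *)
Lemma mix_contraction x z (eta rho b : R) :
  (forall j, \sum_i r i 0 * W i j = r j 0) ->
  0 < eta <= 1 -> (forall i j, (j, i) \in E -> eta <= W i j) ->
  0 < rho -> (forall i, rho <= r i 0) -> 0 < b <= 2^-1 ->
  lyap r z (mix W b x) + rho * eta / (2 * n%:R) * b * edge_disag E x <=
  lyap r z x.
Proof.
move=> rW /andP[eta0 eta1] EW rho0 rho_r /andP[b0 b1].
pose A i j := (1 - b) * (i == j)%:R + b * W i j.
have A0 i j : 0 <= A i j.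
  by rewrite addr_ge0// mulr_ge0// ?ler0n//; lra.
have A1 i : \sum_j A i j = 1.
  rewrite big_split/= -!mulr_sumr W_sum1 (bigD1 i)//= eqxx big1 => [|j ji]; first by rewrite ?mulr1n addr0; ring.
  by rewrite eq_sym (negbTE ji).
have rA j : \sum_i r i 0 * A i j = r j 0.
  under eq_bigr do rewrite mulrDr mulrCA (mulrCA _ b).
  rewrite big_split/= -!mulr_sumr rW (bigD1 j)//= eqxx big1 => [|i ij]; first by rewrite ?mulr1n addr0; ring.
  by rewrite (negbTE ij) mulr0.
have mixE i : mix W b x i - z = \sum_j A i j *: (x j - z).
  under eq_bigr do rewrite scalerBr.
  rewrite sumrB -scaler_suml A1 scale1r; congr (_ - _).
  under eq_bigr do rewrite scalerDl -!scalerA.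
  rewrite big_split/= -!scaler_sumr [X in _ = _ *: X + _](bigD1 i)//= eqxx scale1r.
  rewrite big1 => [|j ji]; last by rewrite eq_sym (negbTE ji) scale0r.
  by rewrite /mix addr0 scalerBr scalerBl scale1r addrA addrAC.
have -> : lyap r z x = \sum_i r i 0 * \sum_j A i j * sqn (x j - z).
  under [RHS]eq_bigr do rewrite mulr_sumr.
  rewrite exchange_big; apply: eq_bigr => j _ /=.
  under eq_bigr do rewrite mulrA.
  by rewrite -mulr_suml rA.
rewrite /lyap /edge_disag mulr_sumr -big_split; apply: ler_sum => i _ /=.
rewrite (variance_identity _ (A1 i)) -mixE mulrDr lerD2l.
have n0 : 0 < n%:R :> R by rewrite ltr0n (leq_ltn_trans _ (ltn_ord i)).
have k0 : 0 <= b * eta by nra.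
have kii : b * eta <= A i i.
  have h1 : b * eta <= b by rewrite ler_piMr// ltW.
  have h2 : 0 <= b * W i i by rewrite mulr_ge0// ltW.
  by rewrite /A eqxx mulr1; lra.
have kij j : (j, i) \in E -> b * eta <= A i j.
  move=> /EW etaW; rewrite /A; have : 0 <= (1 - b) * (i == j)%:R :> R.
    by rewrite mulr_ge0// ?ler0n//; lra.
  by have : b * eta <= b * W i j by [rewrite ler_pM2l]; lra.
have := @variance_ge _ d _ (A i) (fun j => x j - z) (mix W b x i - z) _ i
  (fun j => (j, i) \in E) (A0 i) k0 kii kij.
rewrite card_ord /=.
under eq_bigr do rewrite opprB addrA subrK.
set S1 := \sum_(j | _) _; set S2 := \sum_j _.
have S20 : 0 <= S2 by apply: sumr_ge0 => j _; rewrite mulr_ge0 ?sqn_ge0.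
move=> h; have {}h : b * eta / (2 * n%:R) * S1 <= S2.
  rewrite invfM mulrA -(ler_pM2l n0); apply: le_trans h.
  by rewrite le_eqVlt; apply/orP; left; apply/eqP; field; rewrite gt_eqF.
have -> : rho * eta / (2 * n%:R) * b * S1 = rho * (b * eta / (2 * n%:R) * S1).
  by ring.
apply: le_trans (ler_wpM2l (ltW rho0) h) _.
exact: ler_wpM2r.
Qed.

(** The inner products with the subgradients can be negative when the agents
    disagree.  The two added terms make up for this: [disag] comes with a factor
    [s * b], to be absorbed by the contraction when [s] is small, at the price of
    a factor [s^-1] in front of [a ^+ 2 / b], which is summable. *)
Definition descent (s a b L : R) x g z : R :=
  2 * a * (\sum_i r i 0 * dotv (g i) (x i - z)) + s * b * disag x +
  s^-1 * L ^+ 2 * (a ^+ 2 / b).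

(** The subgradient at [x i] compares [f i (x i)] with [f i z], and the one at
    [x i0] compares it with [f i (x i0)]; the second comparison costs an inner
    product with [x i0 - x i], split by [young] with parameter [s * b]. *)
Lemma descent_ge (s a b L : R) (f : 'I_n -> 'rV[R]_d -> R)
    (G : 'I_n -> 'rV[R]_d -> 'rV[R]_d) x z (i0 : 'I_n) :
  0 < s -> 0 < a -> 0 < b ->
  (forall i y, subgradient (f i) y (G i y)) ->
  (forall i y, sqn (G i y) <= L ^+ 2) ->
  2 * a * (wobjective r f (x i0) - wobjective r f z) <=
  descent s a b L x (fun i => G i (x i)) z.
Proof.
move=> s0 a0 b0 fG GL; rewrite /descent /wobjective -sumrB.
have key i : 2 * a * (r i 0 * f i (x i0) - r i 0 * f i z) <=
    2 * a * (r i 0 * dotv (G i (x i)) (x i - z)) +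
    s * b * (r i 0 * sqn (x i0 - x i)) + s^-1 * L ^+ 2 * (a ^+ 2 / b) * r i 0.
  have sb : 0 < s * b by rewrite mulr_gt0.
  have := young (x i0 - x i) (a *: G i (x i0)) sb.
  rewrite sqnZ dotvZr => h1.
  have h2 : (s * b)^-1 * (a ^+ 2 * sqn (G i (x i0))) <=
      s^-1 * L ^+ 2 * (a ^+ 2 / b).
    rewrite invfM (_ : _ * (a ^+ 2 / b) = s^-1 / b * (a ^+ 2 * L ^+ 2)); last by ring.
    by rewrite ler_pM2l ?mulr_gt0 ?invr_gt0// ler_pM2l ?exprn_gt0.
  have := fG i (x i) z; have := fG i (x i0) (x i).
  rewrite -(opprB (x i0)) -(opprB (x i) z) !dotvNr (dotvC _ (x i0 - x i)) => h3 h4.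
  have h : 2 * a * (f i (x i0) - f i z) <= 2 * a * dotv (G i (x i)) (x i - z) +
      s * b * sqn (x i0 - x i) + s^-1 * L ^+ 2 * (a ^+ 2 / b).
    have : 2 * a * (f i (x i0) - f i z) <= 2 * a * (dotv (G i (x i)) (x i - z) +
       dotv (x i0 - x i) (G i (x i0))) by rewrite ler_pM2l ?mulr_gt0//; lra.
    by move: h1 h2; rewrite mulrDr; lra.
  by have := ler_wpM2l (r_ge0 i) h; rewrite !mulrDr; lra.
rewrite [X in X <= _]mulr_sumr.
apply: le_trans (ler_sum _ (fun i _ => key i)) _.
rewrite !big_split/= -!mulr_sumr r_sum1 mulr1 lerD2r lerD2l.
rewrite ler_pM2l ?mulr_gt0//; apply: le_trans (row_disag_le x i0).
by apply: wsum_le => i; exact: sqn_ge0.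
Qed.

(** Expand the square around the averaged state.  The product of the noise with
    the averaged state is kept, while its product with the subgradients is
    bounded by squares; the inner product of the subgradients with the
    averaged state is moved to [x i], which costs one more [young]. *)
Lemma one_step_le x e g z (s a b L eta rho : R) :
  (forall j, \sum_i r i 0 * W i j = r j 0) ->
  0 < eta <= 1 -> (forall i j, (j, i) \in E -> eta <= W i j) ->
  0 < rho -> (forall i, rho <= r i 0) -> 0 < b <= 2^-1 ->
  0 < s -> (forall i, sqn (g i) <= L ^+ 2) ->
  lyap r z (fun i => mix W b x i + b *: e i - a *: g i) +
    descent s a b L x g z + rho * eta / (2 * n%:R) * b * edge_disag E x <=
  lyap r z x + 2 * b * (\sum_i r i 0 * dotv (mix W b x i - z) (e i)) +
    2 * s * b * disag x + (2 * s^-1 + 2) * L ^+ 2 * (a ^+ 2 / b) +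
    2 * b ^+ 2 * \sum_i sqn (e i).
Proof.
move=> rW heta EW rho0 rho_r hb s0 gL.
have := mix_contraction x z rW heta EW rho0 rho_r hb.
case/andP: hb => b0 b1; rewrite /descent.
have L2 : 0 <= L ^+ 2 := sqr_ge0 L.
have b1' : 1 <= b^-1 by rewrite invf_ge1//; lra.
have a2 : 0 <= a ^+ 2 := sqr_ge0 a.
have ab : a ^+ 2 <= a ^+ 2 / b by rewrite ler_peMr.
have key i : sqn (mix W b x i + b *: e i - a *: g i - z) <=
   sqn (mix W b x i - z) + 2 * b * dotv (mix W b x i - z) (e i)
   - 2 * a * dotv (g i) (x i - z) + s * b * (\sum_j sqn (x i - x j))
   + (s^-1 + 2) * L ^+ 2 * (a ^+ 2 / b) + 2 * b ^+ 2 * sqn (e i).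
  set m := mix W b x i; set p := \sum_j W i j *: x j - x i.
  have -> : m + b *: e i - a *: g i - z = (m - z) + (b *: e i + - (a *: g i)).
    by rewrite [LHS]addrAC (addrAC m) addrA.
  rewrite sqnD; have := sqnD2 (b *: e i) (- (a *: g i)).
  rewrite sqnN !sqnZ => h1.
  have ge : a ^+ 2 * sqn (g i) <= a ^+ 2 * L ^+ 2 by rewrite ler_wpM2l.
  have -> : dotv (m - z) (b *: e i - a *: g i) =
      b * dotv (m - z) (e i) - a * dotv (g i) (x i - z) - b * dotv p (a *: g i).
    rewrite /m /mix -/p !dotvE.
    rewrite (dotvC (g i) (x i)) (dotvC (g i) z); ring.
  have h2 := young p (- (a *: g i)) s0.
  rewrite sqnN sqnZ dotvNr in h2.
  have h3 := drift_sqn_le x i; rewrite -/p in h3.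
  have h4 : 2 * - (b * dotv p (a *: g i)) <=
      s * b * (\sum_j sqn (x i - x j)) + s^-1 * L ^+ 2 * (a ^+ 2 / b).
    have h5 : b * (s^-1 * (a ^+ 2 * sqn (g i))) <= s^-1 * L ^+ 2 * (a ^+ 2 / b).
      apply: (@le_trans _ _ (1 * (s^-1 * (a ^+ 2 * L ^+ 2)))).
        apply: ler_pM.
        - exact: ltW.
        - by rewrite mulr_ge0 ?invr_ge0 ?(ltW s0)// mulr_ge0// sqn_ge0.
        - lra.
        - by rewrite ler_pM2l ?invr_gt0.
      rewrite mul1r -mulrA ler_pM2l ?invr_gt0// mulrC; exact: ler_wpM2l.
    have h6 : b * (s * sqn p) <= s * b * (\sum_j sqn (x i - x j)).
      by rewrite mulrCA mulrA ler_pM2l ?mulr_gt0.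
    by have := ler_wpM2l (ltW b0) h2; rewrite mulrDr; lra.
  have h7 : L ^+ 2 * a ^+ 2 <= L ^+ 2 * (a ^+ 2 / b) by rewrite ler_wpM2l.
  rewrite !mulrDr !mulrDl; lra.
have : lyap r z (fun i => mix W b x i + b *: e i - a *: g i) <=
   lyap r z (mix W b x)
   + 2 * b * (\sum_i r i 0 * dotv (mix W b x i - z) (e i))
   - 2 * a * (\sum_i r i 0 * dotv (g i) (x i - z)) + s * b * disag x
   + (s^-1 + 2) * L ^+ 2 * (a ^+ 2 / b) + 2 * b ^+ 2 * \sum_i sqn (e i).
  apply: le_trans (ler_sum _ (fun i _ => ler_wpM2l (r_ge0 i) (key i))) _.
  under eq_bigr => i _ do
    rewrite !mulrDr mulrN !(mulrCA (r i 0) (2 * _)) (mulrCA (r i 0) (s * b)) (mulrC (r i 0) (_ * (a ^+ 2 / b))).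
  rewrite !big_split/= sumrN -!mulr_sumr r_sum1 mulr1 -!addrA !lerD2l !addrA.
  have h8 : \sum_i r i 0 * (\sum_j sqn (x i - x j)) <= disag x.
    by apply: wsum_le => i; apply: sumr_ge0 => j _; exact: sqn_ge0.
  have h9 : \sum_i r i 0 * sqn (e i) <= \sum_i sqn (e i).
    by apply: wsum_le => i; exact: sqn_ge0.
  rewrite !lerD// ler_wpM2l// mulr_ge0// ?sqr_ge0//; lra.
by move: (a ^+ 2 / b) (disag x) => ? ?; lra.
Qed.

Lemma increment_le x e g (a b L : R) :
  (forall i, sqn (g i) <= L ^+ 2) ->
  \sum_i sqn (mix W b x i + b *: e i - a *: g i - x i) <=
  3 * b ^+ 2 * disag x + 3 * b ^+ 2 * (\sum_i sqn (e i)) +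
  3 * n%:R * L ^+ 2 * a ^+ 2.
Proof.
move=> gL.
have key i : sqn (mix W b x i + b *: e i - a *: g i - x i) <=
    3 * b ^+ 2 * (\sum_j sqn (x i - x j)) + 3 * b ^+ 2 * sqn (e i) +
    3 * L ^+ 2 * a ^+ 2.
  set p := \sum_j W i j *: x j - x i.
  have -> : mix W b x i + b *: e i - a *: g i - x i =
      b *: p + b *: e i + - (a *: g i).
    by rewrite /mix -/p [LHS]addrC !addrA addNr add0r.
  apply: le_trans (sqnD3 _ _ _) _; rewrite sqnN !sqnZ.
  have : b ^+ 2 * sqn p <= b ^+ 2 * (\sum_j sqn (x i - x j)).
    by rewrite ler_wpM2l ?sqr_ge0// drift_sqn_le.
  have : a ^+ 2 * sqn (g i) <= a ^+ 2 * L ^+ 2 by rewrite ler_wpM2l// sqr_ge0.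
  lra.
apply: le_trans (ler_sum _ (fun i _ => key i)) _.
rewrite !big_split/= -!mulr_sumr sumr_const card_ord -/(disag x) -mulr_natl; lra.
Qed.

End one_step.

(** * Windows of joint connectivity *)

Section connectivity_window.
Context {R : realType} {n d : nat}.

Lemma in_bigcup_nat (V : finType) (E : nat -> {set V}) (a b : nat) v :
  v \in (\bigcup_(a <= k < b) E k)%SET -> exists2 k, (a <= k < b)%N & v \in E k.
Proof.
rewrite big_nat; move: v.
apply: (big_ind (fun A : {set V} => forall v, v \in A ->
  exists2 k, (a <= k < b)%N & v \in E k)).
- by move=> v; rewrite inE.
- by move=> A1 A2 h1 h2 v /setUP[/h1|/h2].
- by move=> k kab v vE; exists k.
Qed.

(** Each edge of the path doubles the constant and adds [2 * K]: [4 ^+ size p] is a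
    crude bound. *)
Lemma path_sqn_le (V : finType) (e : rel V) (y : V -> 'rV[R]_d) (K : R)
    (p : seq V) (u : V) :
  0 <= K -> (forall a b, e a b -> sqn (y a - y b) <= K) ->
  path e u p -> sqn (y u - y (last u p)) <= 4 ^+ size p * K.
Proof.
move=> K0 he; elim: p u => [u _|v p IH u /=].
  rewrite expr0 mul1r subrr /sqn /dotv big1// => j _.
  by rewrite mxE mul0r.
move=> /andP[/he uv /IH vp].
have := sqnD2 (y u - y v) (y v - y (last v p)); rewrite addrA subrK exprS.
have : K <= 4 ^+ size p * K by rewrite ler_peMl// exprn_ege1// ler1n.
move: uv vp; set X := 4 ^+ _ * K; rewrite -mulrA -/X; lra.
Qed.

Lemma connected_disag_le (A : {set 'I_n * 'I_n}) (y : 'I_n -> 'rV[R]_d) (K : R) :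
  0 <= K -> strongly_connected A ->
  (forall a b, (a, b) \in A -> sqn (y a - y b) <= K) ->
  disag y <= n%:R ^+ 2 * 4 ^+ n * K.
Proof.
move=> K0 conn he.
have key i j : sqn (y i - y j) <= 4 ^+ n * K.
  have /connectP[p0 /shortenP[p pth up _] ->] := conn i j.
  apply: le_trans (path_sqn_le K0 (fun a b => he a b) pth) _.
  apply: ler_wpM2r => //; apply: ler_weXn2l; first by rewrite ler1n.
  have := max_card (mem (i :: p)); rewrite (card_uniqP up) card_ord /=.
  exact: ltnW.
apply: (@le_trans _ _ (\sum_(i < n) \sum_(j < n) 4 ^+ n * K)).
  by apply: ler_sum => i _; apply: ler_sum => j _.
rewrite -mulrA; move: (4 ^+ n * K) => c.
by rewrite !sumr_const card_ord -mulrnA -[X in X <= _]mulr_natl natrM expr2.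
Qed.

Definition increment (x : nat -> 'I_n -> 'rV[R]_d) (t : nat) : R :=
  \sum_i sqn (x t.+1 i - x t i).

Lemma increment_ge0 x t : 0 <= increment x t.
Proof. by apply: sumr_ge0 => i _; exact: sqn_ge0. Qed.

Lemma telescope_sqn_le (u : nat -> 'rV[R]_d) (k m : nat) : (k <= m)%N ->
  sqn (u m - u k) <= (m - k)%:R * \sum_(k <= l < m) sqn (u l.+1 - u l).
Proof.
move=> km; rewrite -telescope_sumr//.
rewrite -{1 3}(add0n k) !big_addn !big_mkord.
by apply: le_trans (sqn_sum_le _ _) _; rewrite card_ord.
Qed.

(** Each edge of the union graph is present at some time [k] of the window, and
    the square of the distance by which an end of it has moved since then is at
    most [B] times the sum of the later increments; a path of such edges joins
    any two agents.  All the times on the right precede the end of the window, so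
    that for a non-increasing weight [b] the factor [b (t + B)] on the left is at
    most each [b k] on the right. *)
Lemma window_disag_le (x : nat -> 'I_n -> 'rV[R]_d)
    (E : nat -> {set 'I_n * 'I_n}) (t B : nat) :
  (0 < B)%N ->
  strongly_connected (\bigcup_(t.+1 <= k < (t + B).+1) E k)%SET ->
  disag (x (t + B)%N) <= n%:R ^+ 2 * 4 ^+ n * (6 * B%:R) *
    (\sum_(t.+1 <= k < (t + B).+1) (edge_disag (E k) (x k) + increment x k)).
Proof.
move=> B0 conn; set S := \sum_(_ <= k < _) _; rewrite -mulrA.
have t0 k : 0 <= edge_disag (E k) (x k) + increment x k.
  by rewrite addr_ge0 ?edge_disag_ge0 ?increment_ge0.
have S0 : 0 <= S by apply: sumr_ge0.
have B1 : 1 <= B%:R :> R by rewrite ler1n.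
apply: connected_disag_le conn _; first by rewrite !mulr_ge0.
move=> a b /in_bigcup_nat[k kB abE].
have ek : edge_disag (E k) (x k) <= \sum_(t.+1 <= k < (t + B).+1) edge_disag (E k) (x k).
  rewrite (bigD1_seq k) ?mem_index_iota ?iota_uniq//= lerDl.
  by apply: sumr_ge0 => l _; exact: edge_disag_ge0.
have hab : sqn (x k a - x k b) <= edge_disag (E k) (x k).
  rewrite /edge_disag (bigD1 b)//= (bigD1 a)//= sqnC -addrA lerDl addr_ge0//.
    by apply: sumr_ge0 => l _; exact: sqn_ge0.
  by do 2![apply: sumr_ge0 => ? _]; exact: sqn_ge0.
have tel i : sqn (x (t + B)%N i - x k i) <=
    B%:R * \sum_(t.+1 <= k < (t + B).+1) increment x k.
  have [tk kT] := andP kB.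
  apply: le_trans (@telescope_sqn_le (fun l => x l i) k (t + B) kT) _.
  apply: ler_pM; rewrite ?ler0n//.
  - by apply: sumr_ge0 => l _; exact: sqn_ge0.
  - by rewrite ler_nat leq_subLR leq_add2r ltnW.
  apply: (@le_trans _ _ (\sum_(k <= l < t + B) increment x l)).
    apply: ler_sum => l _; rewrite /increment (bigD1 i)//= lerDl.
    by apply: sumr_ge0 => j _; exact: sqn_ge0.
  rewrite [leRHS](@big_cat_nat _ _ _ k)//=; last exact: ltnW.
  rewrite [X in _ + X]big_nat_recr//= addrCA lerDl addr_ge0 ?increment_ge0//.
  by apply: sumr_ge0 => l _; exact: increment_ge0.
have := sqnD3 (x (t + B)%N a - x k a) (x k a - x k b) (x k b - x (t + B)%N b).
rewrite !addrA !subrK (sqnC (x k b)).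
have := tel a; have := tel b; rewrite /S big_split/=.
move: ek hab.
set S1 := \sum_(_ <= k < _) edge_disag _ _; set S2 := \sum_(_ <= k < _) increment _ _.
move=> ek hab.
have S10 : 0 <= S1 by apply: sumr_ge0 => l _; exact: edge_disag_ge0.
have : S1 <= B%:R * S1 by rewrite ler_peMl.
by rewrite -(mulrA 6) (mulrDr B%:R); move: (_ * S1) (_ * S2) => ? ?; lra.
Qed.

End connectivity_window.

(** * Bounded partial sums *)

Section summability.
Context {R : realType}.
Implicit Types (u v : nat -> R).

Definition bounded_sums u := exists M, forall N, \sum_(t < N) u t <= M.

Lemma bounded_sumsD u v :
  bounded_sums u -> bounded_sums v -> bounded_sums (fun t => u t + v t).
Proof.
move=> [M hM] [M' hM']; exists (M + M') => N.
by rewrite big_split lerD.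
Qed.

Lemma bounded_sumsZ (c : R) u : 0 <= c ->
  bounded_sums u -> bounded_sums (fun t => c * u t).
Proof.
by move=> c0 [M hM]; exists (c * M) => N; rewrite -mulr_sumr ler_wpM2l.
Qed.

Lemma le_bounded_sums u v : (forall t, u t <= v t) ->
  bounded_sums v -> bounded_sums u.
Proof.
by move=> uv [M hM]; exists M => N; apply: le_trans (hM N); exact: ler_sum.
Qed.

Lemma bounded_sums_shift (m : nat) u : (forall t, (m <= t)%N -> 0 <= u t) ->
  (\sum_(m <= t <oo) (u t)%:E < +oo)%E ->
  forall k, (m <= k)%N -> bounded_sums (fun t => u (k + t)%N).
Proof.
move=> u0 uoo k mk; exists (fine (\sum_(m <= t <oo) (u t)%:E)%E) => N.
rewrite -lee_fin fineK; last first.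
  by rewrite ge0_fin_numE//; apply: nneseries_ge0 => t mt _; rewrite lee_fin u0.
apply: le_trans (@nneseries_lim_ge _ (fun t => (u t)%:E) xpredT m (k + N) _).
  rewrite sumEFin lee_fin (@big_cat_nat _ _ _ k)//= ?leq_addr//.
  rewrite -{3}(add0n k) big_addn addKn big_mkord.
  under [X in _ <= _ + X]eq_bigr do rewrite addnC.
  by rewrite lerDr big_nat sumr_ge0// => t /andP[mt _]; rewrite u0.
by move=> t mt _; rewrite lee_fin u0.
Qed.

Lemma bounded_sums_lt (e : R) u : 0 < e -> (forall t, 0 <= u t) ->
  bounded_sums u -> exists t, u t < e.
Proof.
move=> e0 u0 [M hM]; apply: contrapT => /forallNP h.
have := hM (Num.truncn (M / e)).+1; apply/negP; rewrite -ltNge.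
apply: (@lt_le_trans _ _ (\sum_(t < (Num.truncn (M / e)).+1) e)).
  by rewrite sumr_const card_ord -mulr_natl -ltr_pdivrMr// Num.Theory.truncnS_gt.
by apply: ler_sum => t _; rewrite leNgt; apply/negP; exact: h.
Qed.

(** Summing the contraction estimate over all windows reproduces the sum of
    [b * D] on the right with the coefficient [K * B * (2 * s / c + 3 * b ^+ 2)],
    which is made at most one half; hence the sums are bounded. *)
Lemma window_absorption (b S D H I w v : nat -> R) (B : nat) (K c s : R) :
  (forall t, 0 <= S t) -> (forall t, 0 <= D t) -> (forall t, 0 <= H t) ->
  (forall t, 0 <= I t) -> (forall t, 0 <= v t) ->
  (forall t, 0 < b t <= 1) -> (forall t t', (t <= t')%N -> b t' <= b t) ->
  0 < K -> 0 < c ->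
  (forall t, S t.+1 + c * b t * H t <= S t + 2 * s * b t * D t + w t) ->
  (forall t, I t <= 3 * b t ^+ 2 * D t + v t) ->
  (forall t, D (t + B)%N <= K * \sum_(t.+1 <= k < (t + B).+1) (H k + I k)) ->
  K * B%:R * (2 * s / c) <= 4^-1 -> K * B%:R * (3 * b 0%N ^+ 2) <= 4^-1 ->
  bounded_sums w -> bounded_sums v ->
  bounded_sums (fun t => b t * D t).
Proof.
move=> S0 D0 H0 I0 v0 b01 bdec K0 c0 hS hI hD hs hb [Mw hw] [Mv hv].
have b0 t : 0 < b t by have /andP[] := b01 t.
have b1 t : b t <= 1 by have /andP[] := b01 t.
pose G t := b t * (H t + I t).
have G0 t : 0 <= G t by rewrite mulr_ge0 ?addr_ge0// ltW.
have bD0 t : 0 <= b t * D t by rewrite mulr_ge0// ltW.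
have mono (u : nat -> R) m N : (forall t, 0 <= u t) ->
    \sum_(t < m) u t <= \sum_(t < m + N) u t.
  by move=> u0; rewrite big_split_ord /= lerDl sumr_ge0.
have step t : b (t + B)%N * D (t + B)%N <= K * \sum_(j < B) G (t + j.+1)%N.
  apply: le_trans (ler_wpM2l (ltW (b0 _)) (hD t)) _.
  rewrite mulrCA ler_pM2l// mulr_sumr -addSn -{1}(add0n t.+1) big_addn addnC.
  rewrite addnK big_mkord; apply: ler_sum => j _.
  have -> : (j + t.+1 = t + j.+1)%N by rewrite addnS addnC -addnS.
  by rewrite /G ler_wpM2r ?addr_ge0// bdec// leq_add2l.
have sumG N : \sum_(t < N) G t <=
    (S 0%N + 2 * s * (\sum_(t < N) b t * D t) + Mw) / c +
    3 * b 0%N ^+ 2 * (\sum_(t < N) b t * D t) + Mv.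
  have h1 : c * \sum_(t < N) b t * H t <=
      S 0%N + 2 * s * (\sum_(t < N) b t * D t) + Mw.
    suff : S N + c * \sum_(t < N) b t * H t <=
        S 0%N + 2 * s * (\sum_(t < N) b t * D t) + \sum_(t < N) w t.
      by have := hw N; have := S0 N; lra.
    elim: N => [|N IH]; first by rewrite !big_ord0; lra.
    rewrite !big_ord_recr /=; have := hS N; rewrite -!mulrA.
    by move: IH; rewrite -!mulrA; lra.
  have h2 : \sum_(t < N) b t * I t <=
      3 * b 0%N ^+ 2 * (\sum_(t < N) b t * D t) + Mv.
    apply: le_trans (lerD (lexx _) (hv N)).
    rewrite mulr_sumr -big_split; apply: ler_sum => t _ /=.
    apply: le_trans (ler_wpM2l (ltW (b0 _)) (hI t)) _.
    rewrite mulrDr; apply: lerD; last by rewrite ler_piMl.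
    rewrite mulrCA; apply: ler_wpM2r => //.
    rewrite ler_pM2l//; apply: lerXn2r; rewrite ?nnegrE; last exact: bdec.
      exact: ltW.
    exact: ltW.
  rewrite mulrC -ler_pdivlMr// in h1.
  rewrite /G; under eq_bigr do rewrite mulrDr.
  by rewrite big_split /= -addrA lerD.
pose C0 := \sum_(t < B) b t * D t.
have main N : \sum_(t < B + N) b t * D t <=
    C0 + K * B%:R * \sum_(t < B + N) G t.
  rewrite big_split_ord /= -/C0 lerD2l.
  under eq_bigr do rewrite addnC.
  apply: le_trans (ler_sum _ (fun (t : 'I_N) _ => step t)) _.
  rewrite -mulr_sumr -mulrA ler_pM2l// exchange_big /=.
  apply: (@le_trans _ _ (\sum_(j < B) \sum_(t < B + N) G t)); last first.
    by rewrite sumr_const card_ord mulr_natl.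
  apply: ler_sum => j _.
  have -> : (B + N = j.+1 + N + (B - j.+1))%N.
    by rewrite addnAC subnKC.
  apply: le_trans (mono _ _ _ G0).
  rewrite [leRHS]big_split_ord /=.
  under [X in _ <= _ + X]eq_bigr do rewrite addnC.
  by rewrite lerDr sumr_ge0.
(* [X <= C0 + K B ((S 0 + Mw) / c + Mv) + X / 2] at time [B + N] *)
exists (2 * (C0 + K * B%:R * ((S 0%N + Mw) / c + Mv))) => N.
apply: le_trans (mono _ N B bD0) _; rewrite addnC.
have := main N; have := sumG (B + N)%N.
set X := \sum_(t < B + N) b t * D t; set Y := \sum_(t < B + N) G t.
have X0 : 0 <= X by exact: sumr_ge0.
move=> hY hX; have KB0 : 0 <= K * B%:R by rewrite mulr_ge0// ltW.
have hX' := le_trans hX (lerD (lexx C0) (ler_wpM2l KB0 hY)).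
have h3 := ler_wpM2r X0 hs; have h4 := ler_wpM2r X0 hb.
have e : K * B%:R * ((S 0%N + 2 * s * X + Mw) / c + 3 * b 0%N ^+ 2 * X + Mv) =
   K * B%:R * ((S 0%N + Mw) / c + Mv) + K * B%:R * (2 * s / c) * X +
   K * B%:R * (3 * b 0%N ^+ 2) * X by ring.
by rewrite e in hX'; lra.
Qed.

End summability.

(** * Integrable functions and orthogonality to the past *)

Section integrability.
Context {disp : measure_display} {T : measurableType disp} {R : realType}.
Variable P : probability T R.
Implicit Types (f g : T -> R) (A : set T).

Definition rint f := P.-integrable setT (EFin \o f).

Lemma rint_measurable f : rint f -> measurable_fun setT f.
Proof. by move=> /measurable_int /measurable_EFinP. Qed.

Lemma rintS f A : measurable A -> rint f -> P.-integrable A (EFin \o f).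
Proof. by move=> mA; apply: integrableS. Qed.

Lemma rint_cst (c : R) : rint (fun=> c).
Proof. exact: finite_measure_integrable_cst. Qed.

Lemma rintD f g : rint f -> rint g -> rint (fun w => f w + g w).
Proof. exact: integrableD. Qed.

Lemma rintZ (c : R) f : rint f -> rint (fun w => c * f w).
Proof. exact: integrableZl. Qed.

Lemma rintB f g : rint f -> rint g -> rint (fun w => f w - g w).
Proof. exact: integrableB. Qed.

Lemma rint_sum (I : Type) (s : seq I) (Q : pred I) (F : I -> T -> R) :
  (forall i, Q i -> rint (F i)) -> rint (fun w => \sum_(i <- s | Q i) F i w).
Proof.
move=> hF; elim: s => [|i s IH].
  by rewrite (_ : (fun=> _) = fun=> 0) ?funeqE => [|w]; [exact: rint_cst|rewrite big_nil].
case Qi: (Q i); last first.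
  by under [X in rint X]funext do rewrite big_cons Qi.
under [X in rint X]funext do rewrite big_cons Qi.
by apply: rintD => //; exact: hF.
Qed.

Lemma le_rint f g : measurable_fun setT f -> (forall w, `|f w| <= g w) ->
  rint g -> rint f.
Proof.
move=> mf fg; apply: le_integrable => //; first exact/measurable_EFinP.
by move=> w _ /=; rewrite lee_fin (le_trans (fg w))// ler_norm.
Qed.

Definition sqint f := measurable_fun setT f /\ rint (fun w => f w ^+ 2).

Lemma sqintM f g : sqint f -> sqint g -> rint (fun w => f w * g w).
Proof.
move=> [mf f2] [mg g2].
apply: (@le_rint _ (fun w => f w ^+ 2 + g w ^+ 2)); last exact: rintD.
  exact: measurable_funM.
move=> w; rewrite normrM -(real_normK (num_real (f w))) -(real_normK (num_real (g w))).
by have := sqr_ge0 (`|f w| - `|g w|); have := sqr_ge0 (`|f w| + `|g w|); nra.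
Qed.

Lemma sqint_cst (c : R) : sqint (fun=> c).
Proof. by split; [exact: measurable_cst|exact: rint_cst]. Qed.

Lemma sqintZ (c : R) f : sqint f -> sqint (fun w => c * f w).
Proof.
move=> [mf f2]; split; first exact: measurable_funM.
by under [X in rint X]funext do rewrite exprMn; exact: rintZ.
Qed.

Lemma sqintD f g : sqint f -> sqint g -> sqint (fun w => f w + g w).
Proof.
move=> hf hg; have [mf f2] := hf; have [mg g2] := hg.
split; first exact: measurable_funD.
rewrite [X in rint X](_ : _ = fun w => f w ^+ 2 + 2 * (f w * g w) + g w ^+ 2).
  by apply: rintD => //; apply: rintD => //; apply: rintZ; exact: sqintM.
by apply/funext => w; ring.
Qed.

Lemma sqintB f g : sqint f -> sqint g -> sqint (fun w => f w - g w).
Proof.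
move=> hf hg; under [X in sqint X]funext do rewrite -mulN1r.
by apply: sqintD => //; exact: sqintZ.
Qed.

Lemma sqint_sum (I : Type) (s : seq I) (Q : pred I) (F : I -> T -> R) :
  (forall i, Q i -> sqint (F i)) -> sqint (fun w => \sum_(i <- s | Q i) F i w).
Proof.
move=> hF; elim: s => [|i s IH].
  by rewrite (_ : (fun=> _) = fun=> 0) ?funeqE => [|w]; [exact: sqint_cst|rewrite big_nil].
case Qi: (Q i); last first.
  by under [X in sqint X]funext do rewrite big_cons Qi.
under [X in sqint X]funext do rewrite big_cons Qi.
by apply: sqintD => //; exact: hF.
Qed.

Lemma sqint_rint f : sqint f -> rint f.
Proof.
move=> hf; have := sqintM hf (sqint_cst 1).
by under [X in rint X]funext do rewrite mulr1.
Qed.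

Lemma bounded_sqint f (M : R) : measurable_fun setT f ->
  (forall w, f w ^+ 2 <= M) -> sqint f.
Proof.
move=> mf fM; split=> //; apply: (@le_rint _ (fun=> M)); last exact: rint_cst.
  exact: measurable_funX.
by move=> w; rewrite ger0_norm ?sqr_ge0.
Qed.

Lemma rint_indicM f A : measurable A -> rint f -> rint (fun w => \1_A w * f w).
Proof.
move=> mA hf; apply: (@le_rint _ (fun w => `|f w|)).
- by apply: measurable_funM; [exact: measurable_indic|exact: rint_measurable].
- move=> w; rewrite normrM ler_piMl// indicE.
  by case: (w \in A); rewrite ?normr1 ?normr0.
- exact: (integrable_norm hf).
Qed.

Lemma Rintegral_indicM f A : measurable A ->
  \int[P]_(w in A) f w = \int[P]_w (\1_A w * f w).
Proof.
move=> mA; rewrite Rintegral_mkcond; congr (Rintegral _ _ _).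
by apply/funext => w; rewrite patchE indicE; case: ifP; rewrite ?mul1r ?mul0r.
Qed.

Lemma Rintegral_sum (I : Type) (s : seq I) (Q : pred I) (F : I -> T -> R) A :
  measurable A -> (forall i, Q i -> rint (F i)) ->
  \int[P]_(w in A) (\sum_(i <- s | Q i) F i w) =
  \sum_(i <- s | Q i) \int[P]_(w in A) F i w.
Proof.
move=> mA hF; elim: s => [|i s IH].
  by under eq_Rintegral do rewrite big_nil; rewrite big_nil Rintegral_cst// mul0r.
rewrite big_cons; case Qi: (Q i).
  under eq_Rintegral do rewrite big_cons Qi.
  rewrite RintegralD ?IH//; apply: rintS => //; [exact: hF|exact: rint_sum].
by under eq_Rintegral do rewrite big_cons Qi.
Qed.

End integrability.

Section orthogonality.
Import HBNNSimple.
Context {disp : measure_display} {T : measurableType disp} {R : realType}.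
Variables (P : probability T R) (G : set (set T)).
Hypothesis subG : <<s G >> `<=` @measurable _ T.

Definition adapted (y : T -> R) :=
  measurable_fun setT (y : g_sigma_algebraType G -> R).

Lemma adapted_measurable y : adapted y -> measurable_fun setT y.
Proof. by move=> my mT B mB; apply: subG; exact: my. Qed.

Variables (e : T -> R).
Hypotheses (ie : rint P e)
  (e0 : forall A, <<s G >> A -> \int[P]_(w in A) e w = 0).

Let cond_orthogonal_ge0 (y : T -> R) : adapted y -> (forall w, 0 <= y w) ->
  rint P (fun w => y w * e w) -> \int[P]_w (y w * e w) = 0.
Proof.
move=> my y0 iye.
have mEy : measurable_fun (setT : set (g_sigma_algebraType G)) (EFin \o y).
  exact/measurable_EFinP.
pose f n : g_sigma_algebraType G -> R := nnsfun_approx measurableT mEy n.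
have f0 n w : 0 <= f n w by exact: fun_ge0.
have fcvg w : f ^~ w @ \oo --> y w.
  have := @cvg_nnsfun_approx _ _ _ _ measurableT _ mEy (fun w _ => y0 w) w I.
  by move/fine_cvgP => [].
have fley n w : f n w <= y w.
  have nd : nondecreasing_seq (f ^~ w).
    by move=> a b ab; have /lefP := nd_nnsfun_approx measurableT mEy ab; exact.
  have := nondecreasing_cvgn_le nd; rewrite (cvg_lim _ (fcvg w))//; apply.
  exact: fcvg.
have fe0 n : \int[P]_(w in [set: T]) (f n w * e w) = 0.
  rewrite /f; set h := nnsfun_approx _ _ _.
  under eq_Rintegral do rewrite (fimfunEord h) mulr_suml.
  have mh i : <<s G >> (h @^-1` [set i]).
    by have := @measurable_funPTI _ _ _ _ h [set i] (measurable_set1 i).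
  rewrite Rintegral_sum//.
    rewrite big1// => i _.
    under eq_Rintegral do rewrite -mulrA.
    rewrite RintegralZl//; last by apply: rint_indicM => //; exact: subG.
    by rewrite -Rintegral_indicM ?e0 ?mulr0//; exact: subG.
  move=> i _; under [X in rint _ X]funext do rewrite -mulrA.
  by apply: rintZ; apply: rint_indicM => //; exact: subG.
have mfe n : measurable_fun setT (fun w : T => f n w * e w).
  apply: measurable_funM; last exact: rint_measurable ie.
  by apply: adapted_measurable; exact: measurable_funP.
have [||||//|_ _] := @dominated_convergence _ _ _ P setT measurableT
  (fun n (w : T) => (f n w * e w)%:E) (fun w => (y w * e w)%:E) (fun w => `|y w * e w|%:E).
- by move=> n; exact/measurable_EFinP.
- by move/measurable_int : iye.
- apply: aeW => w _; apply: cvg_EFin; first exact: nearW.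
  by apply: cvgMl; exact: fcvg.
- exact: (integrable_norm iye).
- apply: aeW => w n _; rewrite lee_fin !normrM ler_wpM2r//.
  by rewrite !ger0_norm.
move=> h; rewrite /Rintegral -(cvg_lim _ h)//.
rewrite (_ : (fun _ => _) = (fun=> 0%E)); first by rewrite lim_cst.
apply/funext => n; rewrite -[LHS]fineK ?[X in X%:E]fe0//.
apply: integrable_fin_num => //; apply: (@le_rint _ _ _ _ _ (fun w => `|y w * e w|)) => //.
  by move=> w; rewrite !normrM ler_wpM2r// !ger0_norm.
exact: (integrable_norm iye).
Qed.

(** A function with zero integral on each event of the sigma-algebra generated by
    [G] is orthogonal to indicators of such events, hence to adapted simple
    functions, and by dominated convergence to all adapted functions. *)
Lemma cond_orthogonal (y : T -> R) A : adapted y -> <<s G >> A ->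
  rint P (fun w => y w * e w) -> \int[P]_(w in A) (y w * e w) = 0.
Proof.
move=> my GA iye; have mA := subG GA.
rewrite Rintegral_indicM//.
pose yp w := Num.max (\1_A w * y w) 0; pose yn w := Num.max (- (\1_A w * y w)) 0.
have m1 : adapted (fun w => \1_A w * y w).
  by apply: measurable_funM => //; exact: measurable_indic.
have split w : \1_A w * y w = yp w - yn w.
  rewrite /yp /yn; move: (\1_A w * y w) => a.
  by case: (leP a 0) => ?; case: (leP (- a) 0) => ?; lra.
have bound w : `|yp w| <= `|y w| /\ `|yn w| <= `|y w|.
  have : `|\1_A w * y w| <= `|y w|.
    rewrite normrM ler_piMl// indicE.
    by case: (w \in A); rewrite ?normr1 ?normr0.
  rewrite /yp /yn; move: (\1_A w * y w) => a; rewrite !ler_norml => /andP[h1 h2].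
  by split; [case: (leP a 0) => ?|case: (leP (- a) 0) => ?]; apply/andP; lra.
have mp : adapted yp by apply: measurable_maxr => //; exact: measurable_cst.
have mn : adapted yn.
  apply: measurable_maxr; last exact: measurable_cst.
  exact: measurable_funN.
have mye z : adapted z -> (forall w, `|z w| <= `|y w|) -> rint P (fun w => z w * e w).
  move=> mz zy; apply: (@le_rint _ _ _ _ _ (fun w => `|y w * e w|)).
  - apply: measurable_funM; last exact: rint_measurable ie.
    exact: adapted_measurable.
  - by move=> w; rewrite !normrM ler_wpM2r.
  - exact: (integrable_norm iye).
have ip : rint P (fun w => yp w * e w) by apply: mye => // w; case: (bound w).
have in' : rint P (fun w => yn w * e w) by apply: mye => // w; case: (bound w).
under eq_Rintegral do rewrite mulrA split mulrBl.
rewrite RintegralB// !cond_orthogonal_ge0 ?subr0// => w; rewrite le_max lexx orbT//.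
Qed.

End orthogonality.

(** * Upcrossings and almost supermartingales *)

Section limit_inferior.
Context {R : realType}.
Variables (u : nat -> R) (l : R).
Hypothesis ul : limn_einf (fun t => (u t)%:E) = l%:E.

Let supE : ereal_sup (range (einfs (fun t => (u t)%:E))) = l%:E.
Proof. by rewrite -ul limn_einf_lim; apply/esym/cvg_lim => //; exact: cvg_einfs_sup. Qed.

Lemma limn_einf_frequently c N : l < c -> exists2 k, (N <= k)%N & u k < c.
Proof.
move=> lc; apply: contrapT => /forall2NP h.
suff : (c%:E <= l%:E)%E by rewrite lee_fin leNgt lc.
rewrite -supE; apply: le_trans (ereal_sup_ubound _); last by exists N.
apply: le_ereal_inf_tmp => _ [k /= Nk <-]; rewrite lee_fin leNgt; apply/negP => kc.
by have [] := h k.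
Qed.

Lemma limn_einf_eventually c : c < l ->
  exists N, forall k, (N <= k)%N -> c < u k.
Proof.
move=> cl.
have /ereal_sup_gt[_ [N _ <-] cN] : (c%:E < ereal_sup (range (einfs (fun t => (u t)%:E))))%E.
  by rewrite supE lte_fin.
exists N => k Nk; rewrite -lte_fin; apply: lt_le_trans cN _.
by apply: ereal_inf_lbound; exists k.
Qed.

End limit_inferior.

Section upcrossings.
Context {disp : measure_display} {T : measurableType disp} {R : realType}.
Variables (P : probability T R) (G : nat -> set (set T)).
Hypothesis subG : forall t, <<s G t >> `<=` @measurable _ T.
Hypothesis incG : forall t, <<s G t >> `<=` <<s G t.+1 >>.
Variables (V : nat -> T -> R) (d : nat -> R).
Hypothesis V_ge0 : forall t w, 0 <= V t w.
Hypothesis V_adapted : forall t, adapted (G t) (V t).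
Hypothesis V_int : forall t, rint P (V t).
Hypothesis V_drift : forall t A, <<s G t >> A ->
  \int[P]_(w in A) V t.+1 w <= \int[P]_(w in A) V t w + d t.
Hypothesis d_sum : bounded_sums d.

Section levels.
Variables a b : R.
Hypotheses (a_ge0 : 0 <= a) (ab : a < b).

(** [upcrossing t] is the event that at time [t] the process has gone below
    [a] and has not exceeded [b] since: holding one unit of [V] exactly at
    these times gains at least [b - a] per completed upcrossing. *)
Fixpoint upcrossing (t : nat) : set T :=
  if t is t'.+1 then
    (upcrossing t' `&` [set w | V t w <= b]) `|`
    (~` upcrossing t' `&` [set w | V t w < a])
  else [set w | V 0%N w < a].

Definition completed (t : nat) : set T := upcrossing t `&` ~` upcrossing t.+1.

Let sublevel t c : <<s G t >> [set w | V t w < c].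
Proof.
have := @V_adapted t measurableT _ (measurable_itv `]-oo, c[).
rewrite setTI (_ : _ @^-1` _ = [set w | V t w < c])//.
Qed.

Let sublevel_le t c : <<s G t >> [set w | V t w <= c].
Proof.
have := @V_adapted t measurableT _ (measurable_itv `]-oo, c]).
rewrite setTI (_ : _ @^-1` _ = [set w | V t w <= c])//.
Qed.

Lemma upcrossing_adapted t : <<s G t >> (upcrossing t).
Proof.
elim: t => [|t IH]; first exact: sublevel.
have gU (A B : set T) : <<s G t.+1 >> A -> <<s G t.+1 >> B -> <<s G t.+1 >> (A `|` B).
  exact: (@measurableU _ (g_sigma_algebraType (G t.+1))).
have gI (A B : set T) : <<s G t.+1 >> A -> <<s G t.+1 >> B -> <<s G t.+1 >> (A `&` B).
  exact: (@measurableI _ (g_sigma_algebraType (G t.+1))).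
apply: gU; apply: gI => //; [exact: incG|apply: sigma_algebraC; exact: incG].
Qed.

Let mup t : measurable (upcrossing t).
Proof. by apply: (@subG t); exact: upcrossing_adapted. Qed.

Lemma completed_measurable t : measurable (completed t).
Proof. by apply: measurableI => //; exact: measurableC. Qed.

(** While a crossing is under way the gain since its start, below [a], is at
    least [V N w - a]; this value is banked, and is more than [b - a], when the
    crossing ends above [b]. *)
Lemma upcrossing_gain N w :
  (b - a) * \sum_(t < N) \1_(completed t) w + \1_(upcrossing N) w * (V N w - a) <=
  \sum_(t < N) \1_(upcrossing t) w * (V t.+1 w - V t w).
Proof.
elim: N => [|N IH].
  rewrite !big_ord0 mulr0 add0r indicE.
  case: (boolP (w \in upcrossing 0)) => [/set_mem /= h|_] /=.
    by rewrite ?mulr1n mul1r; lra.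
  by rewrite ?mulr0n mul0r.
rewrite !big_ord_recr /= mulrDr.
move: IH; set S := \sum_(t < N) _; set S' := \sum_(t < N) _.
rewrite !indicE.
have -> : (w \in completed N) = (w \in upcrossing N) && (w \notin upcrossing N.+1).
  by rewrite /completed in_setI in_setC.
have upS : (w \in upcrossing N.+1) =
    if w \in upcrossing N then V N.+1 w <= b else V N.+1 w < a.
  apply/idP/idP; rewrite inE /=.
    by move=> [[u v]|[u v]]; [rewrite mem_set|rewrite memNset].
  case: ifPn; rewrite ?notin_setE ?inE => h1 h2; [by left|by right].
rewrite upS; case: (w \in upcrossing N) => /=.
  by case: (leP (V N.+1 w) b) => h /=; rewrite ?mulr1n ?mulr0n; nra.
by case: (ltP (V N.+1 w) a) => h /=; rewrite ?mulr1n ?mulr0n; nra.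
Qed.

(** The expected gain is at most the sum of the [d t], as the events [upcrossing t]
    belong to the past of [t]; since [V] is nonnegative, an unfinished crossing
    loses at most [a]. *)
Lemma sum_completed_lty : (\sum_(t <oo) P (completed t) < +oo)%E.
Proof.
have [M hM] := d_sum.
have PE t : P (completed t) = (\int[P]_w \1_(completed t) w)%:E.
  have mc := completed_measurable t.
  by rewrite /Rintegral integral_indic// setIT fineK// fin_num_measure.
have bound N : \sum_(t < N) \int[P]_w \1_(completed t) w <= (M + a) / (b - a).
  have ii A : measurable A -> rint P (\1_A : T -> R).
    by move=> mA; exact: integrable_indic.
  have iS t : rint P (fun w => \1_(upcrossing t) w * (V t.+1 w - V t w)).
    by apply: rint_indicM => //; exact: rintB.
  rewrite ler_pdivlMr ?subr_gt0// mulrC -Rintegral_sum//; last first.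
    by move=> t _; apply: ii; exact: completed_measurable.
  rewrite -RintegralZl//; last first.
    by apply: rint_sum => t _; apply: ii; exact: completed_measurable.
  apply: (@le_trans _ _ (\int[P]_w ((\sum_(t < N) \1_(upcrossing t) w * (V t.+1 w - V t w)) + a))).
    apply: le_Rintegral => //.
    - apply: rintZ; apply: rint_sum => t _; apply: ii; exact: completed_measurable.
    - by apply: rintD; [exact: rint_sum|exact: rint_cst].
    - move=> w _; have := upcrossing_gain N w.
      have : - a <= \1_(upcrossing N) w * (V N w - a).
        rewrite indicE; have := V_ge0 N w.
        by case: (w \in _) => /=; rewrite ?mulr1n ?mulr0n ?mul1r ?mul0r; move: a_ge0; lra.
      by lra.
  rewrite RintegralD//; [|exact: rint_sum|exact: rint_cst].
  have PT : a * fine (P [set: T]) = a.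
    by have -> : P setT = 1%E by [exact: probability_setT]; rewrite mulr1.
  rewrite Rintegral_cst// PT lerD2r.
  apply: le_trans (hM N); rewrite Rintegral_sum//; apply: ler_sum => t _.
  rewrite -Rintegral_indicM// RintegralB//; [|exact: rintS|exact: rintS].
  by rewrite lerBlDl V_drift//; exact: upcrossing_adapted.
apply: (@le_lt_trans _ _ ((M + a) / (b - a))%:E); last exact: ltry.
apply: lime_le; first by apply: is_cvg_nneseries.
apply: nearW => N; rewrite big_mkord.
under eq_bigr do rewrite PE.
by rewrite sumEFin lee_fin.
Qed.

(** After the last completed upcrossing, a path that goes below [a] once more
    starts a crossing which never ends, so it remains at most [b]. *)
Lemma no_oscillation w : ~ lim_sup_set completed w ->
  (forall N, exists2 t, (N <= t)%N & V t w < a) ->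
  exists N, forall t, (N <= t)%N -> V t w <= b.
Proof.
move=> nls io.
have [N hN] : exists N, forall t, (N <= t)%N -> ~ completed t w.
  apply: contrapT => /forallNP h; apply: nls => N _.
  have /existsNP[t /not_implyP[Nt /contrapT ct]] := h N.
  by exists t.
have [t Nt ta] := io N.+1.
have up_t : upcrossing t w.
  case: t Nt ta => // t Nt ta /=.
  have [u|u] := pselect (upcrossing t w); [left|right]; split=> //=.
  exact: ltW (lt_trans ta ab).
have up_after k : upcrossing (t + k)%N w.
  elim: k => [|k IH]; rewrite ?addn0// addnS; apply: contrapT => nu.
  by apply: (hN (t + k)%N); rewrite ?(leq_trans (ltnW Nt)) ?leq_addr.
exists t.+1 => k /subnKC <-.
move: (up_after (k - t.+1)%N) (up_after (k - t.+1).+1) => u.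
rewrite addnS -addSn => -[[] //|[]]; by [].
Qed.

End levels.

Lemma expectation_bounded : exists M, forall t, \int[P]_w V t w <= M.
Proof.
have [M hM] := d_sum; exists (\int[P]_w V 0%N w + M) => t.
apply: le_trans (lerD (lexx _) (hM t)).
elim: t => [|t IH]; first by rewrite big_ord0 addr0.
rewrite big_ord_recr /= addrA; apply: le_trans (lerD IH (lexx _)).
by apply: V_drift; exact: (@measurableT _ (g_sigma_algebraType (G t))).
Qed.

(** Fatou's lemma, as the expectations are bounded. *)
Lemma ae_limn_einf_fin :
  {ae P, forall w, limn_einf (fun t => (V t w)%:E) \is a fin_num}.
Proof.
have mV t : measurable_fun setT (fun w => (V t w)%:E) by exact: measurable_int (V_int t).
have mli : measurable_fun setT (fun w => limn_einf (fun t => (V t w)%:E)).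
  apply: measurableT_comp; first exact: oppe_measurable.
  apply: measurable_fun_limn_esup => t.
  by apply: measurableT_comp; first exact: oppe_measurable.
have li0 w : (0 <= limn_einf (fun t => (V t w)%:E))%E.
  rewrite limn_einf_lim; apply: lime_ge; first exact: is_cvg_einfs.
  by apply: nearW => N; apply: le_ereal_inf_tmp => _ [k _ <-]; rewrite lee_fin.
have ili : P.-integrable setT (fun w => limn_einf (fun t => (V t w)%:E)).
  apply/integrableP; split=> //.
  under eq_integral do rewrite gee0_abs//.
  have [M hM] := expectation_bounded.
  apply: (@le_lt_trans _ _ M%:E); last exact: ltry.
  have := @fatou _ _ _ P _ measurableT (fun t w => (V t w)%:E) mV
    (fun t w _ => V_ge0 t w).
  move/le_trans; apply.
  rewrite limn_einf_lim; apply: lime_le; first exact: is_cvg_einfs.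
  apply: nearW => N; apply: (@le_trans _ _ (\int[P]_w (V N w)%:E)%E).
    by apply: ereal_inf_lbound; exists N => //=.
  rewrite -[leLHS]fineK ?lee_fin ?hM//.
  by apply: integrable_fin_num => //; exact: V_int.
have := integrable_ae measurableT ili.
by apply: filterS => w; exact.
Qed.

Lemma ae_forall_count (I : countType) (Q : I -> T -> Prop) :
  (forall i, {ae P, forall w, Q i w}) -> {ae P, forall w, forall i, Q i w}.
Proof.
move=> hQ.
have : {ae P, forall w, forall k, if unpickle k is Some i then Q i w else True}.
  by apply: ae_foralln => k; case: unpickle => [i|]; [exact: hQ|exact: aeW].
by apply: filterS => w h i; have := h (pickle i); rewrite pickleK.
Qed.

(** Almost surely the lower limit is finite and no pair of rational levels is
    crossed infinitely often; the errors [d] only add their sum to the expected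
    gain of the upcrossing strategy. *)
Theorem almost_supermartingale_cvg :
  {ae P, forall w, exists l : R, V ^~ w @ \oo --> l}.
Proof.
have osc : {ae P, forall w, forall pq : rat * rat,
    0 <= ratr pq.1 :> R -> ratr pq.1 < ratr pq.2 :> R ->
    ~ lim_sup_set (completed (ratr pq.1) (ratr pq.2)) w}.
  apply: ae_forall_count => -[p q] /=.
  have [p0|_] := boolP (0 <= ratr p :> R); last by apply: aeW.
  have [pq|_] := boolP (ratr p < ratr q :> R); last by apply: aeW.
  have mc := completed_measurable (ratr p) (ratr q).
  exists (lim_sup_set (completed (ratr p) (ratr q))); split.
  - by apply: bigcap_measurable => // k _; exact: bigcup_measurable.
  - by apply: lim_sup_set_cvg0 => //; exact: sum_completed_lty.
  - by move=> w /=; apply: contra_notP => h _ _.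
apply: filterS2 osc ae_limn_einf_fin => w osc /fineK/esym hl.
set l := fine _ in hl; exists l.
have l0 : 0 <= l.
  rewrite leNgt; apply/negP => l_lt0.
  have [k _] := limn_einf_frequently hl 0%N l_lt0.
  by rewrite ltNge V_ge0.
apply/cvgrPdist_lt => eps eps0.
have leps : l < l + eps by rewrite ltrDl.
have [q] := rat_in_itvoo leps; rewrite in_itv /= => /andP[lq qeps].
have [p] := rat_in_itvoo lq; rewrite in_itv /= => /andP[lp pq].
have p0 : 0 <= ratr p :> R by exact: ltW (le_lt_trans l0 lp).
have [N1 h1] := no_oscillation pq (osc (p, q) p0 pq)
  (fun N => limn_einf_frequently hl N lp).
have [|N2 h2] := limn_einf_eventually hl (c := l - eps); first by rewrite ltrBlDr ltrDl.
exists (maxn N1 N2) => // k /=; rewrite geq_max => /andP[/h1 ? /h2 ?].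
by rewrite ltr_norml; apply/andP; lra.
Qed.

End upcrossings.

(** * Almost sure summability *)

Section almost_sure_summability.
Context {disp : measure_display} {T : measurableType disp} {R : realType}.
Variable P : probability T R.

Lemma ae_bounded_sums (Y : nat -> T -> R) :
  (forall t w, 0 <= Y t w) -> (forall t, rint P (Y t)) ->
  bounded_sums (fun t => \int[P]_w Y t w) ->
  {ae P, forall w, bounded_sums (Y ^~ w)}.
Proof.
move=> Y0 iY [M hM].
have mY t : measurable_fun setT (fun w => (Y t w)%:E) by exact: measurable_int (iY t).
pose S w := (\sum_(t <oo) (Y t w)%:E)%E.
have S0 w : (0 <= S w)%E by apply: nneseries_ge0 => t _ _; rewrite lee_fin.
have iS : P.-integrable setT S.
  apply/integrableP; split; first by apply: ge0_emeasurable_sum => // t w _ _; rewrite lee_fin.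
  under eq_integral do rewrite gee0_abs//.
  rewrite integral_nneseries//; last by move=> t w _; rewrite lee_fin.
  apply: (@le_lt_trans _ _ M%:E); last exact: ltry.
  apply: lime_le.
    by apply: is_cvg_nneseries => t _ _; apply: integral_ge0 => w _; rewrite lee_fin.
  apply: nearW => N; rewrite big_mkord.
  apply: le_trans (_ : (\sum_(t < N) \int[P]_w Y t w)%:E <= _)%E; last by rewrite lee_fin.
  rewrite -sumEFin; apply: lee_sum => t _.
  by rewrite fineK//; apply: integrable_fin_num => //; exact: iY.
apply: filterS (integrable_ae measurableT iS) => w /(_ I) Sw.
exists (fine (S w)) => N; rewrite -lee_fin fineK// -sumEFin -(big_mkord xpredT (fun t => (Y t w)%:E)).
by apply: nneseries_lim_ge => t _; rewrite lee_fin.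
Qed.

End almost_sure_summability.

(** * Convergence of a single path *)

Section paths.
Context {R : realType} {n d : nat}.

Lemma bounded_sums_eventually (u v : nat -> R) N :
  (forall t, 0 <= v t) -> (forall t, (N <= t)%N -> u t <= v t) ->
  bounded_sums v -> bounded_sums u.
Proof.
move=> v0 uv [M hM]; exists (M + \sum_(t < N) `|u t|) => m.
pose w t := if (t < N)%N then `|u t| else 0.
have w0 t : 0 <= w t by rewrite /w; case: ifP.
apply: (@le_trans _ _ (\sum_(t < m) (v t + w t))).
  apply: ler_sum => t _; rewrite /w; case: ltnP => [_|/uv]; last by rewrite addr0.
  by rewrite (le_trans (ler_norm _))// lerDr.
rewrite big_split /=; apply: lerD; first exact: hM.
apply: (@le_trans _ _ (\sum_(t < m + N) w t)).
  by rewrite [leRHS]big_split_ord /= lerDl sumr_ge0.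
rewrite addnC big_split_ord /= [X in _ + X]big1 ?addr0 => [|t _].
  by apply: ler_sum => t _; rewrite /w ltn_ord.
by rewrite /w ltnNge leq_addr.
Qed.

Lemma cvg_sqn (u : nat -> 'rV[R]_d) (p : 'rV[R]_d) :
  (forall e, 0 < e -> exists N, forall t, (N <= t)%N -> sqn (u t - p) < e) ->
  u t @[t --> \oo] --> p.
Proof.
move=> h; apply/cvg_ballP => e e0.
have [N hN] := h (e ^+ 2) (exprn_gt0 2 e0).
exists N => // t /= /hN ht; split=> // i j.
rewrite /ball /= ord1 distrC; have := le_lt_trans (coord_sqr_le (u t - p) j) ht.
by rewrite !mxE ltr_norml; move: (_ - _) => a ae; apply/andP; nra.
Qed.

(** Bolzano-Weierstrass: [u] stays in a compact box around [z]. *)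
Lemma cluster_sqn (u : nat -> 'rV[R]_d) (z : 'rV[R]_d) (M : R) :
  (forall t, sqn (u t - z) <= M) ->
  exists p, forall e N, 0 < e -> exists2 t, (N <= t)%N & sqn (u t - p) < e.
Proof.
move=> uM; have M0 : 0 <= M := le_trans (sqn_ge0 _) (uM 0%N).
pose A := [set v : 'rV[R]_d | forall j, v 0 j \in `[z 0 j - (1 + M), z 0 j + (1 + M)]].
have cA : compact A.
  exact: (@rV_compact _ _ (fun j => [set` `[z 0 j - (1 + M), z 0 j + (1 + M)]])
    (fun j => @segment_compact _ _ _)).
have Au t : A (u t).
  move=> j; rewrite in_itv /=.
  by have := le_trans (coord_sqr_le (u t - z) j) (uM t); rewrite !mxE; nra.
have FA : (u x @[x --> \oo]) A by exists 0%N => // t _; exact: Au.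
have [p [_ clp]] := cA _ _ FA.
exists p => e N e0.
pose c := e / (1 + d%:R).
have d0 : 0 <= d%:R :> R by rewrite ler0n.
have c0 : 0 < c by rewrite divr_gt0// ltr_pwDl.
have m0 : 0 < Num.min 1 c by rewrite lt_min ltr01.
have tail : (u x @[x --> \oo]) (u @` [set t | (N <= t)%N]).
  by exists N => // t /= Nt; exists t.
have [_ [[t Nt <-] [_ bt]]] := clp _ _ tail (nbhsx_ballx p _ m0).
exists t => //; apply: (@le_lt_trans _ _ (\sum_(j < d) c)).
  apply: ler_sum => j _; have := bt 0 j.
  rewrite /ball /= lt_min !mxE => /andP[].
  rewrite -normrN opprB; move: (_ - _) => a; rewrite !ltr_norml => /andP[? ?] /andP[? ?].
  by case: (leP 0 a) => ?; nra.
rewrite sumr_const card_ord -mulr_natl /c mulrA ltr_pdivrMr ?ltr_pwDl//; nra.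
Qed.

Context (r : 'cV[R]_n) (f : 'I_n -> 'rV[R]_d -> R)
  (g : 'I_n -> 'rV[R]_d -> 'rV[R]_d).
Hypothesis r_gt0 : forall i, 0 < r i 0.
Hypothesis r_sum1 : \sum_i r i 0 = 1.
Hypothesis fg : forall i x, subgradient (f i) x (g i x).

Let r_ge0 i : 0 <= r i 0. Proof. exact: ltW. Qed.

Lemma wobjective_subgradient p y :
  wobjective r f p + dotv (\sum_i r i 0 *: g i p) (y - p) <= wobjective r f y.
Proof.
rewrite /wobjective dotv_suml -big_split; apply: ler_sum => i _ /=.
by rewrite dotvZl -mulrDr ler_wpM2l// fg.
Qed.

(** A weighted sum of subgradients at [p] bounds [wobjective r f] from below near
    [p]; hence lower semicontinuity. *)
Lemma wobjective_lsc p (c : R) :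
  (forall e, 0 < e -> exists x, sqn (x - p) < e /\ wobjective r f x < c + e) ->
  wobjective r f p <= c.
Proof.
move=> h; apply/ler_addgt0Pr => e e0.
pose s := e / (1 + sqn (\sum_i r i 0 *: g i p)).
have G0 := sqn_ge0 (\sum_i r i 0 *: g i p).
have s0 : 0 < s by rewrite divr_gt0// ltr_pwDl.
have m0 : 0 < Num.min (e / 4) (s * e / 2).
  by rewrite lt_min !divr_gt0// mulr_gt0.
have [x []] := h _ m0; rewrite !lt_min => /andP[_ x2] xc.
have := wobjective_subgradient p x.
have := young (\sum_i r i 0 *: g i p) (- (x - p)) s0; rewrite sqnN dotvNr.
have : s * sqn (\sum_i r i 0 *: g i p) <= e.
  by rewrite /s mulrAC ler_pdivrMr ?ltr_pwDl//; nra.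
have : s^-1 * sqn (x - p) <= e / 2.
  by rewrite ler_pdivrMl// mulrA ltW.
have : wobjective r f x < c + e / 4.
  by apply: lt_le_trans xc _; rewrite lerD2l ge_min lexx.
lra.
Qed.

(** If from some time on [F] or [D] is at least [e], then [a] is bounded by a
    multiple of the sum of the three summable sequences: in the second case because
    [2 k a <= a ^+ 2 / b + b * k ^+ 2] and [k ^+ 2 <= D]. *)
Lemma frequently_optimal (a b F D : nat -> R) :
  (forall t, 0 < a t) -> (forall t, 0 < b t) ->
  (forall t, 0 <= F t) -> (forall t, 0 <= D t) ->
  bounded_sums (fun t => a t * F t) -> bounded_sums (fun t => b t * D t) ->
  bounded_sums (fun t => a t ^+ 2 / b t) -> ~ bounded_sums a ->
  forall e N, 0 < e -> exists2 t, (N <= t)%N & F t < e /\ D t < e.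
Proof.
move=> a0 b0 F0 D0 hF hD hab na e N e0; apply: contrapT => /forall2NP h.
apply: na; pose k := Num.min 1 e.
have k0 : 0 < k by rewrite lt_min ltr01.
have ke : k <= e by rewrite ge_min lexx orbT.
have k1 : k <= 1 by rewrite ge_min lexx.
have ab0 t : 0 <= a t ^+ 2 / b t by rewrite divr_ge0 ?sqr_ge0// ltW.
have ik : 0 <= (2 * k)^-1 by rewrite invr_ge0 mulr_ge0// ltW.
have ie : 0 <= e^-1 by rewrite invr_ge0 ltW.
have eF0 t : 0 <= e^-1 * (a t * F t) by rewrite !mulr_ge0// ltW.
have kD0 t : 0 <= (2 * k)^-1 * (a t ^+ 2 / b t + b t * D t).
  by rewrite mulr_ge0// addr_ge0// mulr_ge0// ltW.
apply: (@bounded_sums_eventually _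
  (fun t => e^-1 * (a t * F t) + (2 * k)^-1 * (a t ^+ 2 / b t + b t * D t)) N).
- by move=> t; rewrite addr_ge0.
- move=> t Nt; have [//|/not_andP[]/negP] := h t; rewrite -leNgt => he.
    have : a t <= e^-1 * (a t * F t).
      by rewrite mulrCA ler_peMr ?(ltW (a0 t))// mulrC ler_pdivlMr// mul1r.
    by have := kD0 t; lra.
  have := eF0 t; suff : a t <= (2 * k)^-1 * (a t ^+ 2 / b t + b t * D t) by lra.
  rewrite ler_pdivlMl ?mulr_gt0//.
  have : b t * k ^+ 2 <= b t * D t.
    by rewrite ler_pM2l//; apply: le_trans he; nra.
  have : 0 <= (a t - k * b t) ^+ 2 / b t by rewrite divr_ge0 ?sqr_ge0// ltW.
  have -> : (a t - k * b t) ^+ 2 / b t = a t ^+ 2 / b t - 2 * k * a t + b t * k ^+ 2.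
    by field; rewrite gt_eqF.
  lra.
- apply: bounded_sumsD; apply: bounded_sumsZ => //.
  exact: bounded_sumsD.
Qed.

Lemma lyap_triangle (x : 'I_n -> 'rV[R]_d) p z :
  lyap r p x <= 2 * lyap r z x + 2 * sqn (p - z).
Proof.
have -> : 2 * sqn (p - z) = \sum_i r i 0 * (2 * sqn (p - z)).
  by rewrite -mulr_suml r_sum1 mul1r.
rewrite /lyap mulr_sumr -big_split.
apply: ler_sum => i _ /=; have := sqnD2 (x i - z) (z - p).
by rewrite addrA subrK (sqnC z) => h; have := ler_wpM2l (r_ge0 i) h; lra.
Qed.

Lemma lyap_near (x : 'I_n -> 'rV[R]_d) p i0 :
  lyap r p x <= 2 * disag x + 2 * sqn (x i0 - p).
Proof.
apply: (@le_trans _ _ (\sum_i r i 0 * (2 * disag x + 2 * sqn (x i0 - p)))).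
  apply: ler_sum => i _; rewrite ler_wpM2l//.
  have := sqnD2 (x i - x i0) (x i0 - p); have := pair_disag_le x i i0.
  by rewrite addrA subrK; lra.
by rewrite -mulr_suml r_sum1 mul1r.
Qed.

(** A cluster point of the nearly optimal times is a minimizer; the distance to a
    member of the dense family close to it converges, and is small at some of
    these times, hence at all late times. *)
Lemma pathwise_limit (x : nat -> 'I_n -> 'rV[R]_d) (a b : nat -> R)
    (zs : 'rV[R]_d) (I : Type) (Z : I -> 'rV[R]_d) (i0 : 'I_n) :
  argmin (wobjective r f) zs ->
  (forall t, 0 < a t) -> (forall t, 0 < b t) ->
  bounded_sums (fun t => a t * (wobjective r f (x t i0) - wobjective r f zs)) ->
  bounded_sums (fun t => b t * disag (x t)) ->
  bounded_sums (fun t => a t ^+ 2 / b t) -> ~ bounded_sums a ->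
  (forall p e, argmin (wobjective r f) p -> 0 < e ->
     exists k, sqn (p - Z k) < e) ->
  (forall k, exists l : R, lyap r (Z k) (x t) @[t --> \oo] --> l) ->
  exists2 p, argmin (wobjective r f) p & forall i, x t i @[t --> \oo] --> p.
Proof.
move=> zsmin a0 b0 hF hD hab na Zdense Zcvg.
have F0 t : 0 <= wobjective r f (x t i0) - wobjective r f zs.
  by rewrite subr_ge0; exact: zsmin.
have freq := frequently_optimal a0 b0 F0 (fun t => disag_ge0 (x t)) hF hD hab na.
have ltl k t : r i0 0 * sqn (x t i0 - Z k) <= lyap r (Z k) (x t).
  rewrite /lyap (bigD1 i0)//= lerDl.
  by apply: sumr_ge0 => i _; rewrite mulr_ge0// sqn_ge0.
(* bounded, hence with a cluster point along the good times *)
have [k0 _] := Zdense _ _ zsmin ltr01.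
have [l0 /cvgrPdist_lt/(_ _ ltr01)[N0 _ hN0]] := Zcvg k0.
have good_ (m : nat) : exists t, [/\ (m <= t)%N, (N0 <= t)%N,
    wobjective r f (x t i0) - wobjective r f zs < m.+1%:R^-1 &
    disag (x t) < m.+1%:R^-1].
  have e0 : 0 < m.+1%:R^-1 :> R by rewrite invr_gt0 ltr0n.
  have [t] := freq _ (maxn m N0) e0; rewrite geq_max => /andP[? ?] [? ?].
  by exists t.
have [tau htau] := choice good_.
have bounded m : sqn (x (tau m) i0 - Z k0) <= (l0 + 1) / r i0 0.
  have [_ h _ _] := htau m; have := hN0 _ h; rewrite /= ltr_norml => /andP[? _].
  by rewrite ler_pdivlMr// mulrC (le_trans (ltl _ _))//; lra.
have [p hp] := cluster_sqn bounded.
have near_p e N : 0 < e -> exists t, [/\ (N <= t)%N,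
    sqn (x t i0 - p) < e, wobjective r f (x t i0) < wobjective r f zs + e &
    disag (x t) < e].
  move=> e0; pose m0 := Num.truncn e^-1.
  have [m Nm hm] := hp e (maxn N m0) e0.
  have [mt _ hF' hD'] := htau m.
  move: Nm; rewrite geq_max => /andP[Nm mm].
  have me : m.+1%:R^-1 < e.
    rewrite invf_plt ?posrE ?ltr0n//; apply: lt_le_trans (truncnS_gt _) _.
    by rewrite ler_nat ltnS.
  exists (tau m); split=> //; first exact: leq_trans Nm mt.
    by rewrite -ltrBlDl (lt_trans hF' me).
  exact: lt_trans hD' me.
have pmin : argmin (wobjective r f) p.
  move=> y; apply: le_trans (zsmin y); apply: wobjective_lsc => e e0.
  by have [t [_ ? ? _]] := near_p e 0%N e0; exists (x t i0).
exists p => // i; apply: cvg_sqn => e e0.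
(* [lyap r p <= 2 (l + h) + 2 h] with [l <= 11 h], that is less than [30 h] *)
pose h := r i 0 * e / 30.
have h0 : 0 < h by rewrite divr_gt0 ?mulr_gt0.
have [k hk] := Zdense p h pmin h0.
have [l /cvgrPdist_lt cl] := Zcvg k.
have [N1 _ hN1] := cl _ h0.
have lh : l <= 11 * h.
  have [t [Nt tp _ tD]] := near_p h N1 h0.
  have := hN1 _ Nt; rewrite /= ltr_norml => /andP[_ ?].
  have := lyap_triangle (x t) (Z k) p; rewrite sqnC.
  have := lyap_near (x t) p i0; lra.
exists N1 => t /= /hN1; rewrite ltr_norml => /andP[? _].
rewrite -(ltr_pM2l (r_gt0 i)); apply: (@le_lt_trans _ _ (lyap r p (x t))).
  rewrite /lyap (bigD1 i)//= lerDl.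
  by apply: sumr_ge0 => j _; rewrite mulr_ge0// sqn_ge0.
have := lyap_triangle (x t) p (Z k).
have : r i 0 * e = 30 * h by rewrite /h; lra.
lra.
Qed.
End paths.

(** * Square integrable vectors and dense families *)

Section square_integrable_vectors.
Context {disp : measure_display} {T : measurableType disp} {R : realType} {d : nat}.
Variable P : probability T R.
Implicit Types X Y : T -> 'rV[R]_d.

Definition vsqint X := forall j, sqint P (fun w => X w 0 j).

Lemma vsqint_cst (c : 'rV[R]_d) : vsqint (fun=> c).
Proof. by move=> j; exact: sqint_cst. Qed.

Lemma vsqintD X Y : vsqint X -> vsqint Y -> vsqint (fun w => X w + Y w).
Proof. by move=> hX hY j; under [X in sqint _ X]funext do rewrite mxE; exact: sqintD. Qed.

Lemma vsqintZ (c : R) X : vsqint X -> vsqint (fun w => c *: X w).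
Proof. by move=> hX j; under [X in sqint _ X]funext do rewrite mxE; exact: sqintZ. Qed.

Lemma vsqintB X Y : vsqint X -> vsqint Y -> vsqint (fun w => X w - Y w).
Proof. by move=> hX hY j; under [X in sqint _ X]funext do rewrite !mxE; exact: sqintB. Qed.

Lemma vsqint_sum (I : Type) (s : seq I) (F : I -> T -> 'rV[R]_d) :
  (forall i, vsqint (F i)) -> vsqint (fun w => \sum_(i <- s) F i w).
Proof.
by move=> hF j; under [X in sqint _ X]funext do rewrite summxE; apply: sqint_sum => i _; exact: hF.
Qed.

Lemma rint_dotv X Y : vsqint X -> vsqint Y -> rint P (fun w => dotv (X w) (Y w)).
Proof. move=> hX hY; rewrite /dotv; apply: rint_sum => j _. exact: sqintM (hX j) (hY j). Qed.

Lemma rint_sqn X : vsqint X -> rint P (fun w => sqn (X w)).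
Proof. by move=> hX; exact: rint_dotv. Qed.

Lemma bounded_vsqint X (M : R) : random_vector X -> (forall w, sqn (X w) <= M) ->
  vsqint X.
Proof.
move=> mX XM j; apply: (@bounded_sqint _ _ _ P _ M); first exact: mX.
by move=> w; apply: le_trans (XM w); exact: coord_sqr_le.
Qed.

Lemma rint_sqn_vsqint X : random_vector X -> rint P (fun w => sqn (X w)) -> vsqint X.
Proof.
move=> mX iX j; split; first exact: mX.
apply: le_rint iX; first by apply: measurable_funX; exact: mX.
by move=> w; rewrite ger0_norm ?sqr_ge0// coord_sqr_le.
Qed.

Lemma le_Rintegral_sub (f : T -> R) (A : set T) : measurable A ->
  rint P f -> (forall w, 0 <= f w) -> \int[P]_(w in A) f w <= \int[P]_w f w.
Proof.
move=> mA hf f0; rewrite Rintegral_indicM//; apply: le_Rintegral => //.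
  exact: rint_indicM.
move=> w _; rewrite indicE; case: (w \in A); rewrite ?mul1r ?mul0r//.
Qed.

Lemma adapted_sqn (G : set (set T)) X :
  (forall j, adapted G (fun w => X w 0 j)) -> adapted G (fun w => sqn (X w)).
Proof.
move=> aX; rewrite /adapted /sqn /dotv.
apply: (@measurable_sum _ (g_sigma_algebraType G) R setT _ _ (fun j w => X w 0 j * X w 0 j)) => j.
by apply: measurable_funM; exact: aX.
Qed.

Lemma Rintegral_setT_cst (c : R) : \int[P]_w c = c.
Proof.
have PT : c * fine (P [set: T]) = c.
  by have -> : P setT = 1%E by [exact: probability_setT]; rewrite mulr1.
by rewrite Rintegral_cst// PT.
Qed.

Lemma le_Rintegral_combination (A : set T) (c c' : R) (f1 f2 f3 g1 g2 g3 : T -> R) :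
  measurable A -> rint P f1 -> rint P f2 -> rint P f3 ->
  rint P g1 -> rint P g2 -> rint P g3 ->
  (forall w, f1 w + f2 w + c * f3 w <= g1 w + c' * g2 w + g3 w) ->
  \int[P]_(w in A) f1 w + \int[P]_(w in A) f2 w + c * \int[P]_(w in A) f3 w <=
  \int[P]_(w in A) g1 w + c' * \int[P]_(w in A) g2 w + \int[P]_(w in A) g3 w.
Proof.
move=> mA i1 i2 i3 j1 j2 j3 h.
have k3 : rint P (fun w => c * f3 w) by exact: rintZ.
have l2 : rint P (fun w => c' * g2 w) by exact: rintZ.
have k12 : rint P (fun w => f1 w + f2 w) by exact: rintD.
have l12 : rint P (fun w => g1 w + c' * g2 w) by exact: rintD.
have k : rint P (fun w => f1 w + f2 w + c * f3 w) by exact: rintD.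
have l : rint P (fun w => g1 w + c' * g2 w + g3 w) by exact: rintD.
have := le_Rintegral mA (rintS mA k) (rintS mA l) (fun w _ => h w).
rewrite (RintegralD mA (rintS mA k12) (rintS mA k3)).
rewrite (RintegralD mA (rintS mA i1) (rintS mA i2)) (RintegralZl _ mA (rintS mA i3)).
rewrite (RintegralD mA (rintS mA l12) (rintS mA j3)).
by rewrite (RintegralD mA (rintS mA j1) (rintS mA l2)) (RintegralZl _ mA (rintS mA j2)).
Qed.

Lemma ae_Rintegral_le (Y : T -> R) (c : R) :
  rint P Y -> {ae P, forall w, Y w <= c} -> \int[P]_w Y w <= c.
Proof.
move=> iY Yc; have mY := rint_measurable iY.
have mm : measurable_fun setT (fun w => Num.min (Y w) c) by exact: measurable_minr.
have -> : \int[P]_w Y w = \int[P]_w Num.min (Y w) c.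
  congr fine; apply: ae_eq_integral => //; try exact/measurable_EFinP.
  by apply: filterS Yc => w Ywc _ /=; rewrite min_l.
rewrite -[leRHS]Rintegral_setT_cst; apply: le_Rintegral => //; last 2 first.
- exact: rint_cst.
- by move=> w _; rewrite ge_min lexx orbT.
apply: (@le_rint _ _ _ _ _ (fun w => `|Y w| + `|c|)) => //.
  by move=> w; rewrite minEle; case: ifP; rewrite ?lerDl ?lerDr.
by apply: rintD; [exact: (integrable_norm iY)|exact: rint_cst].
Qed.

End square_integrable_vectors.

(** For each rational point and each radius, a point of [A] in that ball is chosen
    if there is one; so the family lies in [A], even if no point of [A] is
    rational. *)
Lemma countable_dense (R : realType) (d : nat) (A : set 'rV[R]_d) : A !=set0 ->
  exists Z : 'rV[rat]_d * nat -> 'rV[R]_d, (forall k, A (Z k)) /\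
    forall p e, A p -> 0 < e -> exists k, sqn (p - Z k) < e.
Proof.
move=> [z0 Az0].
pose near (qk : 'rV[rat]_d * nat) (z : 'rV[R]_d) :=
  sqn (z - map_mx ratr qk.1) < qk.2.+1%:R^-1.
have /choice[Z hZ] (qk : 'rV[rat]_d * nat) :
    exists z, A z /\ ((exists2 z', A z' & near qk z') -> near qk z).
  have [[z Az nz]|h] := pselect (exists2 z', A z' & near qk z').
    by exists z.
  by exists z0; split=> // /h.
exists Z; split=> [k|p e Ap e0]; first by have [] := hZ k.
pose k := Num.truncn (4 / e).
have k0 : 0 < k.+1%:R^-1 :> R by rewrite invr_gt0 ltr0n.
have ke : 4 * k.+1%:R^-1 < e.
  by rewrite ltr_pdivrMr ?ltr0n// mulrC -ltr_pdivrMr// truncnS_gt.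
have d0 : 0 <= d%:R :> R by rewrite ler0n.
(* a factor [d.+1] to sum over the coordinates; [del <= 1] gives [del ^+ 2 <= del] *)
pose del : R := k.+1%:R^-1 / d.+1%:R.
have del0 : 0 < del by rewrite divr_gt0// ltr0n.
have del1 : del <= 1.
  rewrite ler_pdivrMr ?ltr0n// mul1r; apply: (@le_trans _ _ 1).
    by rewrite invf_le1 ?ltr0n// ler1n.
  by rewrite ler1n.
have /choice[q hq] (j : 'I_d) : exists q : rat, p 0 j - del < ratr q < p 0 j + del.
  have /rat_in_itvoo[q] : p 0 j - del < p 0 j + del by lra.
  by rewrite in_itv /= => ?; exists q.
have nq z : near (\row_j q j, k) z -> A z -> near (\row_j q j, k) (Z (\row_j q j, k)).
  by move=> nz Az; have [_] := hZ (\row_j q j, k); apply; exists z.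
have np : near (\row_j q j, k) p.
  rewrite /near /=; apply: (@le_lt_trans _ _ (\sum_(j < d) del)).
    apply: ler_sum => j _; have := hq j; rewrite !mxE => /andP[].
    move: (p 0 j) (ratr _) => a b *; nra.
  rewrite sumr_const card_ord -[X in X < _]mulr_natl /del mulrCA gtr_pMr//.
  by rewrite ltr_pdivrMr ?ltr0n// mul1r ltr_nat.
exists (\row_j q j, k); have := nq _ np Ap; rewrite /near /= => nZ.
have := sqnD2 (p - map_mx ratr (\row_j q j)) (map_mx ratr (\row_j q j) - Z (\row_j q j, k)).
rewrite addrA subrK (sqnC (map_mx _ _)).
by move: np nZ ke; rewrite /near /=; move: (k.+1%:R^-1) => c; lra.
Qed.

(** * The random process *)

Section network_process.
Context {R : realType} {disp : measure_display} {T : measurableType disp}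
  {P : probability T R} {n d : nat}.
Variables (r : 'cV[R]_n) (E : nat -> {set 'I_n * 'I_n}) (W : nat -> 'M[R]_n)
  (f : 'I_n -> 'rV[R]_d -> R) (g : 'I_n -> 'rV[R]_d -> 'rV[R]_d)
  (alpha beta : nat -> R) (e x xhat : nat -> 'I_n -> T -> 'rV[R]_d)
  (x1 : 'I_n -> 'rV[R]_d) (gamma eta L : R) (B : nat).
Hypotheses (hr : stochastic_pos r)
  (hWE : forall t i j, (1 <= t)%N -> (0 < W t i j <-> (j, i) \in E t))
  (hg : forall i y, subgradient (f i) y (g i y))
  (he : forall t i, (1 <= t)%N -> random_vector (e t i))
  (hx : forall t i, (1 <= t)%N -> random_vector (x t i))
  (hx1 : forall i w, x 1%N i w = x1 i)
  (hxhat : forall t i w, (1 <= t)%N ->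
    xhat t i w = \sum_(j < n) W t i j *: x t j w + e t i w)
  (hdyn : forall t i w, (1 <= t)%N ->
    x t.+1 i w = (1 - beta t) *: x t i w + beta t *: xhat t i w
                 - alpha t *: g i (x t i w))
  (hnoise : noise_assumption P
    (natural_filtration (fun t w => \matrix_(i < n) x t i w)) e gamma)
  (hconn : connectivity_assumption r E W eta B)
  (hobj : objective_assumption r f L)
  (alpha_gt0 : forall t, (1 <= t)%N -> 0 < alpha t)
  (beta_01 : forall t, (1 <= t)%N -> 0 < beta t <= 1).

Let r_gt0 i : 0 < r i 0. Proof. exact: stochastic_gt0 hr i. Qed.
Let r_ge0 i : 0 <= r i 0. Proof. exact: ltW. Qed.
Let r_sum1 : \sum_i r i 0 = 1. Proof. exact: stochastic_sum1 hr. Qed.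

Let W_sum1 t i : (1 <= t)%N -> \sum_j W t i j = 1.
Proof.
move=> t1; have /matrixP/(_ i 0) := conn_W_row hconn t1.
by rewrite !mxE => <-; apply: eq_bigr => j _; rewrite mxE mulr1.
Qed.

Let rW_sum t j : (1 <= t)%N -> \sum_i r i 0 * W t i j = r j 0.
Proof.
move=> t1; have /matrixP/(_ 0 j) := conn_W_r hconn t1.
by rewrite !mxE => <-; apply: eq_bigr => i _; rewrite mxE.
Qed.

Let W_ge0 t i j : (1 <= t)%N -> 0 <= W t i j.
Proof. by move=> t1; exact: conn_W_ge0 hconn t i j t1. Qed.

Let EW t i j : (1 <= t)%N -> (j, i) \in E t -> eta <= W t i j.
Proof. by move=> t1 /(hWE i j t1); exact: conn_eta hconn t i j t1. Qed.

Let eta_01 (i : 'I_n) : 0 < eta <= 1.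
Proof.
rewrite (conn_eta_gt0 hconn) /=.
have [j Wj] : exists j, 0 < W 1%N i j.
  apply: contrapT => /forallNP h; have := @W_sum1 1%N i erefl.
  rewrite big1 => [|j _]; first by move/esym/eqP; rewrite oner_eq0.
  by apply/eqP; rewrite eq_le W_ge0// andbT leNgt; apply/negP; exact: h.
apply: le_trans (conn_eta hconn _ Wj) _ => //.
rewrite -(@W_sum1 1%N i erefl) (bigD1 j)//= lerDl.
by apply: sumr_ge0 => k _; exact: W_ge0.
Qed.

Let g_le i y : sqn (g i y) <= L ^+ 2.
Proof.
rewrite -enorm_sqr; apply: lerXn2r; rewrite ?nnegrE ?sqrtr_ge0//.
  exact: ltW (obj_L_gt0 hobj).
exact: ltW (obj_L hobj (hg i y)).
Qed.

Let mean_coord t i w j :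
  (\sum_k W t i k *: x t k w) 0 j = \sum_k W t i k * x t k w 0 j.
Proof. by rewrite summxE; apply: eq_bigr => k _; rewrite mxE. Qed.

Lemma dynE t i w : (1 <= t)%N -> x t.+1 i w =
  mix (W t) (beta t) (fun j => x t j w) i + beta t *: e t i w -
  alpha t *: g i (x t i w).
Proof.
move=> t1; rewrite hdyn// hxhat//; congr (_ - _).
by rewrite /mix scalerDr scalerBr scalerBl scale1r !addrA; congr (_ + _); rewrite addrAC.
Qed.

(** ** Integrability *)

(** [g] itself may fail to be Borel; the dynamics expresses its value along the
    process through measurable vectors. *)
Lemma g_random t i : (1 <= t)%N -> random_vector (fun w => g i (x t i w)).
Proof.
move=> t1 j.
rewrite [X in measurable_fun _ X](_ : _ = fun w => (alpha t)^-1 *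
   (((1 - beta t) * x t i w 0 j +
     beta t * (\sum_k W t i k * x t k w 0 j + e t i w 0 j)) - x t.+1 i w 0 j)).
  apply: measurable_funM => //; apply: measurable_funB; last exact: hx.
  apply: measurable_funD; apply: measurable_funM => //; first exact: hx.
  apply: measurable_funD; last exact: he.
  by apply: measurable_sum => k; apply: measurable_funM => //; exact: hx.
apply/funext => w; rewrite hdyn// hxhat// !mxE mean_coord.
by field; rewrite gt_eqF// alpha_gt0.
Qed.

Lemma g_vsqint t i : (1 <= t)%N -> vsqint P (fun w => g i (x t i w)).
Proof. by move=> t1; apply: (@bounded_vsqint _ _ _ _ P _ (L ^+ 2)) => //; exact: g_random. Qed.

Lemma e_sqn_int t i : (1 <= t)%N -> rint P (fun w => sqn (e t i w)).
Proof.
move=> t1; have [Y [+ _ _ _] _] := noise_var hnoise i t1.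
by rewrite /rint; under [X in EFin \o X]funext do rewrite enorm_sqr.
Qed.

Lemma e_vsqint t i : (1 <= t)%N -> vsqint P (e t i).
Proof. by move=> t1; apply: rint_sqn_vsqint; [exact: he|exact: e_sqn_int]. Qed.

Lemma mix_vsqint t i : (forall j, vsqint P (x t j)) ->
  vsqint P (fun w => mix (W t) (beta t) (fun j => x t j w) i).
Proof.
move=> xt; apply: vsqintD => //; apply: vsqintZ; apply: vsqintB => //.
by apply: vsqint_sum => j; exact: vsqintZ.
Qed.

Lemma x_vsqint t i : (1 <= t)%N -> vsqint P (x t i).
Proof.
case: t => // t _; elim: t i => [i|t IH i].
  by rewrite (_ : x 1%N i = fun=> x1 i); [exact: vsqint_cst|apply/funext].
rewrite (_ : x t.+2 i = fun w =>
    mix (W t.+1) (beta t.+1) (fun j => x t.+1 j w) i + beta t.+1 *: e t.+1 i w -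
    alpha t.+1 *: g i (x t.+1 i w)); last by apply/funext => w; rewrite dynE.
apply: vsqintB; last by apply: vsqintZ; exact: g_vsqint.
by apply: vsqintD; [exact: mix_vsqint|apply: vsqintZ; exact: e_vsqint].
Qed.

Lemma e_sqn_le t i : (1 <= t)%N -> \int[P]_w sqn (e t i w) <= gamma.
Proof.
move=> t1; have [Y [_ iY _ hY] Yg] := noise_var hnoise i t1.
have {hY} := hY setT (@measurableT _ (g_sigma_algebraType _)).
under [X in _ = X -> _]eq_integral do rewrite enorm_sqr.
by move=> hY; rewrite /Rintegral -hY; exact: ae_Rintegral_le.
Qed.

(** ** Adaptedness *)

Definition generators (t : nat) : set (set T) :=
  [set A | exists s i j, (1 <= s <= t)%N /\
    preimage_set_system setT (fun w => (\matrix_(i < n) x s i w) i j) measurable A].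

Lemma generators_measurable t : <<s generators t >> `<=` @measurable _ T.
Proof.
apply: smallest_sub; first exact: sigma_algebra_measurable.
move=> A [s [i [j [/andP[s1 _] [Y mY <-]]]]].
under [X in _ `&` X @^-1` _]funext do rewrite mxE.
by apply: hx.
Qed.

Lemma generatorsS t : <<s generators t >> `<=` <<s generators t.+1 >>.
Proof.
apply: smallest_sub; first exact: smallest_sigma_algebra.
move=> A [s [i [j [/andP[s1 st] h]]]]; apply: sub_sigma_algebra.
by exists s, i, j; split=> //; rewrite s1 leqW.
Qed.

Lemma x_adapted t i j : (1 <= t)%N -> adapted (generators t) (fun w => x t i w 0 j).
Proof.
move=> t1 _ Y mY; apply: sub_sigma_algebra; exists t, i, j; rewrite t1 leqnn; split=> //.
by exists Y => //; under [X in _ `&` X @^-1` _]funext do rewrite mxE.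
Qed.

Lemma lyap_adapted t z : (1 <= t)%N ->
  adapted (generators t) (fun w => lyap r z (fun i => x t i w)).
Proof.
move=> t1; apply: (@measurable_sum _ (g_sigma_algebraType (generators t)) R setT _ _
  (fun i w => r i 0 * sqn (x t i w - z))) => i.
apply: measurable_funM => //; apply: adapted_sqn => j.
rewrite (_ : (fun w => _) = fun w => x t i w 0 j - z 0 j).
  by apply: measurable_funB => //; exact: x_adapted.
by apply/funext => w; rewrite !mxE.
Qed.

Lemma mix_adapted t i j : (1 <= t)%N -> adapted (generators t)
  (fun w => mix (W t) (beta t) (fun k => x t k w) i 0 j).
Proof.
move=> t1; rewrite (_ : (fun w => _) = fun w => x t i w 0 j + beta t *
    (\sum_k W t i k * x t k w 0 j - x t i w 0 j)); last first.
  by apply/funext => w; rewrite !mxE mean_coord.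
apply: measurable_funD; first exact: x_adapted.
apply: measurable_funM => //; apply: measurable_funB; last exact: x_adapted.
apply: (@measurable_sum _ (g_sigma_algebraType (generators t)) R setT _ _
  (fun k w => W t i k * x t k w 0 j)) => k.
by apply: measurable_funM => //; exact: x_adapted.
Qed.

(** Coordinatewise [cond_orthogonal]: the averaged state is adapted. *)
Lemma noise_orthogonal t z A : (1 <= t)%N -> <<s generators t >> A ->
  \int[P]_(w in A) (\sum_i r i 0 *
    dotv (mix (W t) (beta t) (fun j => x t j w) i - z) (e t i w)) = 0.
Proof.
move=> t1 GA; have mA := generators_measurable GA.
have mi i : vsqint P (fun w => mix (W t) (beta t) (fun j => x t j w) i - z).
  apply: vsqintB; last exact: vsqint_cst.
  by apply: mix_vsqint => j; exact: x_vsqint.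
rewrite Rintegral_sum//; last first.
  by move=> i _; apply: rintZ; apply: rint_dotv => //; exact: e_vsqint.
rewrite big1// => i _; rewrite RintegralZl//; last first.
  by apply: rintS => //; apply: rint_dotv => //; exact: e_vsqint.
rewrite /dotv Rintegral_sum//; last first.
  by move=> j _; apply: sqintM; [exact: mi|exact: e_vsqint].
rewrite big1 ?mulr0// => j _.
apply: (@cond_orthogonal _ _ _ P (generators t) (@generators_measurable t)
  (fun w => e t i w 0 j)).
- exact: sqint_rint (e_vsqint i t1 j).
- move=> A' GA'; have := cond_exp_integral (noise_mean0 hnoise i t1 j) GA'.
  by rewrite /Rintegral => <-; rewrite integral0_eq.
- rewrite (_ : (fun w => _) = fun w =>
    mix (W t) (beta t) (fun k => x t k w) i 0 j - z 0 j).
    by apply: measurable_funB => //; exact: mix_adapted.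
  by apply/funext => w; rewrite !mxE.
- exact: GA.
- by apply: sqintM; [exact: mi|exact: e_vsqint].
Qed.

(** ** Moment estimates *)

Let X t w := fun i => x t i w.

Lemma lyap_rint t z : (1 <= t)%N -> rint P (fun w => lyap r z (X t w)).
Proof.
move=> t1; apply: rint_sum => i _; apply: rintZ; apply: rint_sqn.
by apply: vsqintB; [exact: x_vsqint|exact: vsqint_cst].
Qed.

Let pair_rint t i j : (1 <= t)%N -> rint P (fun w => sqn (x t i w - x t j w)).
Proof. by move=> t1; apply: rint_sqn; apply: vsqintB; exact: x_vsqint. Qed.

Lemma disag_rint t : (1 <= t)%N -> rint P (fun w => disag (X t w)).
Proof. by move=> t1; do 2![apply: rint_sum => ? _]; exact: pair_rint. Qed.

Lemma edge_disag_rint t : (1 <= t)%N -> rint P (fun w => edge_disag (E t) (X t w)).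
Proof. by move=> t1; do 2![apply: rint_sum => ? _]; exact: pair_rint. Qed.

Lemma increment_rint t : (1 <= t)%N ->
  rint P (fun w => increment (fun t => X t w) t).
Proof.
move=> t1; apply: rint_sum => i _; apply: rint_sqn.
by apply: vsqintB; exact: x_vsqint.
Qed.

Let G t w := fun i => g i (x t i w).

Lemma descent_rint s t z : (1 <= t)%N ->
  rint P (fun w => descent r s (alpha t) (beta t) L (X t w) (G t w) z).
Proof.
move=> t1; apply: rintD; last exact: rint_cst.
apply: rintD; apply: rintZ; last exact: disag_rint.
apply: rint_sum => i _; apply: rintZ; apply: rint_dotv; first exact: g_vsqint.
by apply: vsqintB; [exact: x_vsqint|exact: vsqint_cst].
Qed.

Let noise_rint t z : (1 <= t)%N -> rint P (fun w => \sum_i r i 0 *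
  dotv (mix (W t) (beta t) (X t w) i - z) (e t i w)).
Proof.
move=> t1; apply: rint_sum => i _; apply: rintZ; apply: rint_dotv; last exact: e_vsqint.
apply: vsqintB; last exact: vsqint_cst.
by apply: mix_vsqint => j; exact: x_vsqint.
Qed.

Lemma descent_ge0 s t z (i0 : 'I_n) w : (1 <= t)%N -> 0 < s ->
  argmin (wobjective r f) z ->
  0 <= descent r s (alpha t) (beta t) L (X t w) (G t w) z.
Proof.
move=> t1 s0 zmin; have [b0 _] := andP (beta_01 t1).
apply: le_trans (descent_ge r_ge0 r_sum1 _ z i0 s0 (alpha_gt0 t1) b0 hg g_le).
by rewrite mulr_ge0 ?mulr_ge0 ?subr_ge0// ?ltW ?alpha_gt0//; exact: zmin.
Qed.

Let sum_e_rint t : (1 <= t)%N -> rint P (fun w => \sum_i sqn (e t i w)).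
Proof. by move=> t1; apply: rint_sum => i _; exact: e_sqn_int. Qed.

Let sum_e_le t : (1 <= t)%N -> \int[P]_w (\sum_i sqn (e t i w)) <= n%:R * gamma.
Proof.
move=> t1; rewrite Rintegral_sum//; last by move=> i _; exact: e_sqn_int.
apply: (@le_trans _ _ (\sum_(i < n) gamma)).
  by apply: ler_sum => i _; exact: e_sqn_le.
by rewrite sumr_const card_ord mulr_natl.
Qed.

Definition error s t : R :=
  (2 * s^-1 + 2) * L ^+ 2 * (alpha t ^+ 2 / beta t) + 2 * beta t ^+ 2 * (n%:R * gamma).

(** [one_step_le] integrated over an event of the past, where the noise term
    vanishes.  The error terms are nonnegative, and are integrated over the whole
    space: this makes them independent of the event. *)
Lemma expected_drift rho s t z A (i0 : 'I_n) : (1 <= t)%N -> beta t <= 2^-1 ->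
  0 < rho -> (forall i, rho <= r i 0) -> 0 < s -> <<s generators t >> A ->
  \int[P]_(w in A) lyap r z (X t.+1 w) +
  \int[P]_(w in A) descent r s (alpha t) (beta t) L (X t w) (G t w) z +
  rho * eta / (2 * n%:R) * beta t * \int[P]_(w in A) edge_disag (E t) (X t w) <=
  \int[P]_(w in A) lyap r z (X t w) +
  2 * s * beta t * \int[P]_w disag (X t w) + error s t.
Proof.
move=> t1 bt rho0 rho_r s0 GA; have mA := generators_measurable GA.
have [b0 _] := andP (beta_01 t1).
pose N w := \sum_i r i 0 * dotv (mix (W t) (beta t) (X t w) i - z) (e t i w).
pose C0 := (2 * s^-1 + 2) * L ^+ 2 * (alpha t ^+ 2 / beta t).
have C00 : 0 <= C0.
  have h1 : 0 <= alpha t ^+ 2 / beta t by rewrite divr_ge0 ?sqr_ge0// ltW.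
  have h2 : 0 <= 2 * s^-1 + 2 by rewrite addr_ge0// mulr_ge0// invr_ge0 ltW.
  exact: mulr_ge0 (mulr_ge0 h2 (sqr_ge0 L)) h1.
pose Err w := 2 * s * beta t * disag (X t w) + (C0 + 2 * beta t ^+ 2 * \sum_i sqn (e t i w)).
have iErr : rint P Err.
  apply: rintD; first by apply: rintZ; exact: disag_rint.
  by apply: rintD; [exact: rint_cst|apply: rintZ; exact: sum_e_rint].
have Err0 w : 0 <= Err w.
  apply: addr_ge0.
    by rewrite mulr_ge0 ?disag_ge0// mulr_ge0// ?mulr_ge0// ltW.
  apply: addr_ge0 => //; apply: mulr_ge0; first by rewrite mulr_ge0 ?sqr_ge0.
  by apply: sumr_ge0 => i _; exact: sqn_ge0.
have ErrE : \int[P]_w Err w <= 2 * s * beta t * \int[P]_w disag (X t w) + error s t.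
  rewrite RintegralD//; first last.
  - by apply: rintD; [exact: rint_cst|apply: rintZ; exact: sum_e_rint].
  - by apply: rintZ; exact: disag_rint.
  rewrite RintegralZl//; last exact: disag_rint.
  rewrite lerD2l RintegralD//; first last.
  - by apply: rintZ; exact: sum_e_rint.
  - exact: rint_cst.
  rewrite Rintegral_setT_cst /error lerD2l RintegralZl//; last exact: sum_e_rint.
  by rewrite ler_wpM2l ?sum_e_le// mulr_ge0// sqr_ge0.
pose c := rho * eta / (2 * n%:R) * beta t.
have key w : lyap r z (X t.+1 w) + descent r s (alpha t) (beta t) L (X t w) (G t w) z +
    c * edge_disag (E t) (X t w) <= lyap r z (X t w) + 2 * beta t * N w + Err w.
  have b01 : 0 < beta t <= 2^-1 by rewrite b0.
  have -> : X t.+1 w = fun i => mix (W t) (beta t) (X t w) i +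
      beta t *: e t i w - alpha t *: G t w i.
    by apply/funext => i; exact: dynE.
  have := @one_step_le R n d r (W t) (E t) r_ge0 r_sum1 (fun i j => W_ge0 i j t1)
    (fun i => W_sum1 i t1) (X t w) (e t ^~ w) (G t w) z s (alpha t) (beta t) L
    eta rho (fun j => rW_sum j t1) (eta_01 i0) (fun i j => @EW t i j t1) rho0 rho_r
    b01 s0 (fun i => g_le i (x t i w)).
  rewrite /Err /C0 /c /N -/(G t w); move: (alpha t ^+ 2 / beta t) => q; lra.
have iS' := lyap_rint z (leqW t1 : (1 <= t.+1)%N).
have iS := lyap_rint z t1.
have ib := descent_rint s z t1.
have := le_Rintegral_combination mA iS' ib (edge_disag_rint t1) iS (noise_rint z t1) iErr key.
rewrite noise_orthogonal// mulr0 addr0 -/c.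
have := le_Rintegral_sub mA iErr Err0; lra.
Qed.

Lemma expected_increment t : (1 <= t)%N ->
  \int[P]_w increment (fun t => X t w) t <=
  3 * beta t ^+ 2 * \int[P]_w disag (X t w) +
  (3 * beta t ^+ 2 * (n%:R * gamma) + 3 * n%:R * L ^+ 2 * alpha t ^+ 2).
Proof.
move=> t1.
apply: (@le_trans _ _ (\int[P]_w (3 * beta t ^+ 2 * disag (X t w) +
   (3 * beta t ^+ 2 * (\sum_i sqn (e t i w)) + 3 * n%:R * L ^+ 2 * alpha t ^+ 2)))).
  apply: le_Rintegral => //.
  - exact: increment_rint.
  - apply: rintD; first by apply: rintZ; exact: disag_rint.
    by apply: rintD; [apply: rintZ; exact: sum_e_rint|exact: rint_cst].
  - move=> w _; have := @increment_le R n d (W t) (fun i j => W_ge0 i j t1)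
      (fun i => W_sum1 i t1) (X t w) (e t ^~ w) (G t w) (alpha t) (beta t) L
      (fun i => g_le i (x t i w)).
    rewrite addrA; apply: le_trans; rewrite /increment.
    by under eq_bigr do rewrite /X dynE//.
rewrite RintegralD//; first last.
- by apply: rintD; [apply: rintZ; exact: sum_e_rint|exact: rint_cst].
- by apply: rintZ; exact: disag_rint.
rewrite RintegralZl//; last exact: disag_rint.
rewrite lerD2l RintegralD//; first last.
- exact: rint_cst.
- by apply: rintZ; exact: sum_e_rint.
rewrite Rintegral_setT_cst lerD2r RintegralZl//; last exact: sum_e_rint.
by rewrite ler_wpM2l ?sum_e_le// mulr_ge0// sqr_ge0.
Qed.

Lemma expected_window t : (1 <= t)%N ->
  \int[P]_w disag (X (t + B)%N w) <= n%:R ^+ 2 * 4 ^+ n * (6 * B%:R) *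
    \sum_(t.+1 <= k < (t + B).+1)
      (\int[P]_w edge_disag (E k) (X k w) + \int[P]_w increment (fun t => X t w) k).
Proof.
move=> t1.
have i1 k : (t.+1 <= k)%N -> rint P (fun w => edge_disag (E k) (X k w)).
  by move=> tk; apply: edge_disag_rint; exact: leq_ltn_trans tk.
have i2 k : (t.+1 <= k)%N -> rint P (fun w => increment (fun t => X t w) k).
  by move=> tk; apply: increment_rint; exact: leq_ltn_trans tk.
have iS : rint P (fun w => \sum_(t.+1 <= k < (t + B).+1)
    (edge_disag (E k) (X k w) + increment (fun t => X t w) k)).
  under [X in rint P X]funext do rewrite big_nat.
  by apply: rint_sum => k /andP[tk _]; apply: rintD; [exact: i1|exact: i2].
rewrite (_ : \sum_(_ <= k < _) _ = \int[P]_w (\sum_(t.+1 <= k < (t + B).+1)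
    (edge_disag (E k) (X k w) + increment (fun t => X t w) k))); last first.
  under [in RHS]eq_Rintegral do rewrite big_nat.
  rewrite big_nat Rintegral_sum//; last first.
    by move=> k /andP[tk _]; apply: rintD; [exact: i1|exact: i2].
  by apply: eq_bigr => k /andP[tk _]; rewrite RintegralD//; [exact: i1|exact: i2].
rewrite -RintegralZl//; apply: le_Rintegral => //.
- by apply: disag_rint; rewrite addn_gt0 t1.
- exact: rintZ.
- move=> w _; apply: (@window_disag_le _ _ _ (fun t => X t w)).
    exact: conn_B_gt0 hconn.
  exact: conn_strong hconn t t1.
Qed.

(** ** Convergence *)

Hypothesis beta_noninc : forall t u, (1 <= t <= u)%N -> beta u <= beta t.
Hypothesis alpha_sums : forall k, (1 <= k)%N ->
  ~ bounded_sums (fun t => alpha (k + t)%N).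
Hypothesis alpha2_sums : forall k, (1 <= k)%N ->
  bounded_sums (fun t => alpha (k + t)%N ^+ 2).
Hypothesis beta2_sums : forall k, (1 <= k)%N ->
  bounded_sums (fun t => beta (k + t)%N ^+ 2).
Hypothesis alpha2_beta_sums : forall k, (1 <= k)%N ->
  bounded_sums (fun t => alpha (k + t)%N ^+ 2 / beta (k + t)%N).

Let error_sums s k : 0 < s -> (1 <= k)%N -> bounded_sums (fun t => error s (k + t)).
Proof.
move=> s0 k1; apply: bounded_sumsD; last first.
  under [X in bounded_sums X]funext do rewrite mulrAC.
  apply: bounded_sumsZ; last exact: beta2_sums.
  by rewrite !mulr_ge0// ltW// (noise_gamma_gt0 hnoise).
apply: bounded_sumsZ; last exact: alpha2_beta_sums.
by rewrite mulr_ge0 ?sqr_ge0// addr_ge0// mulr_ge0// invr_ge0 ltW.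
Qed.

(** The drift inequality and the window inequality in expectation are exactly the
    hypotheses of [window_absorption], from a time [k] after which [beta] is
    small. *)
Lemma weighted_disag_sums (rho : R) (i0 : 'I_n) :
  0 < rho -> (forall i, rho <= r i 0) ->
  exists k, [/\ (1 <= k)%N, forall t, beta (k + t)%N <= 2^-1 &
    bounded_sums (fun t => beta (k + t)%N * \int[P]_w disag (X (k + t) w))].
Proof.
move=> rho0 rho_r.
have [zs zsmin] := obj_argmin hobj.
have n0 : 0 < n%:R :> R by rewrite ltr0n (leq_ltn_trans _ (ltn_ord i0)).
have B0 : (0 < B)%N := conn_B_gt0 hconn.
pose K : R := n%:R ^+ 2 * 4 ^+ n * (6 * B%:R).
have BR : 0 < B%:R :> R by rewrite ltr0n.
have K0 : 0 < K by rewrite !mulr_gt0// exprn_gt0.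
have KB : 0 < K * B%:R by rewrite mulr_gt0.
pose c := rho * eta / (2 * n%:R).
have c0 : 0 < c by rewrite divr_gt0 ?mulr_gt0// (conn_eta_gt0 hconn).
(* so that [K * B * (2 * s / c)] is one quarter *)
pose s := c / (8 * (K * B%:R)).
have s0 : 0 < s by rewrite divr_gt0// mulr_gt0.
have m0 : 0 < Num.min (4^-1) (12 * (K * B%:R))^-1 :> R.
  by rewrite lt_min !invr_gt0 ltr0n /= mulr_gt0.
have [t] := bounded_sums_lt m0 (fun t => sqr_ge0 _) (beta2_sums (erefl : 1 <= 1)%N).
rewrite lt_min => /andP[bt4 btK]; pose k := (1 + t)%N; exists k.
have b0 u : 0 < beta (k + u)%N by have /andP[] := @beta_01 (k + u)%N erefl.
have bhalf u : beta (k + u)%N <= 2^-1.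
  apply: (@le_trans _ _ (beta k)); first by rewrite beta_noninc// leq_addr.
  by have := b0 0%N; rewrite addn0; move: bt4; rewrite -/k; nra.
split=> //.
apply: (@window_absorption _ (fun u => beta (k + u)%N)
  (fun u => \int[P]_w lyap r zs (X (k + u) w))
  (fun u => \int[P]_w disag (X (k + u) w))
  (fun u => \int[P]_w edge_disag (E (k + u)) (X (k + u) w))
  (fun u => \int[P]_w increment (fun t => X t w) (k + u))
  (fun u => error s (k + u))
  (fun u => 3 * beta (k + u)%N ^+ 2 * (n%:R * gamma) +
            3 * n%:R * L ^+ 2 * alpha (k + u)%N ^+ 2) B K c s) => //.
- by move=> u; apply: Rintegral_ge0 => w _; exact: lyap_ge0.
- by move=> u; apply: Rintegral_ge0 => w _; exact: disag_ge0.
- by move=> u; apply: Rintegral_ge0 => w _; exact: edge_disag_ge0.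
- by move=> u; apply: Rintegral_ge0 => w _; exact: increment_ge0.
- move=> u; have g0 := ltW (noise_gamma_gt0 hnoise).
  apply: addr_ge0; apply: mulr_ge0; rewrite ?sqr_ge0//.
  - by rewrite mulr_ge0 ?sqr_ge0.
  - by rewrite mulr_ge0.
  - by rewrite mulr_ge0 ?sqr_ge0.
- by move=> u; exact: beta_01.
- by move=> u u' uu'; rewrite beta_noninc//= leq_add2l.
- move=> u; have := @expected_drift rho s (k + u) zs setT i0 erefl (bhalf u) rho0
    rho_r s0 (@measurableT _ (g_sigma_algebraType (generators (k + u)))).
  rewrite addnS -/c; have : 0 <= \int[P]_w
      descent r s (alpha (k + u)%N) (beta (k + u)%N) L (X (k + u) w) (G (k + u) w) zs.
    by apply: Rintegral_ge0 => w _; exact: descent_ge0.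
  lra.
- by move=> u; exact: expected_increment.
- move=> u; have := @expected_window (k + u) erefl; rewrite -/K addnA.
  rewrite (_ : \sum_(_ <= _ < _) _ = \sum_(u.+1 <= l < (u + B).+1)
    (\int[P]_w edge_disag (E (k + l)) (X (k + l) w) +
     \int[P]_w increment (fun t => X t w) (k + l)))//.
  rewrite -addnS -addnA -addnS (addnC k u.+1) big_addn addKn.
  by apply: eq_bigr => l _; rewrite (addnC l).
- rewrite le_eqVlt; apply/orP; left; apply/eqP; rewrite /s; field.
  by rewrite !gt_eqF// mulr_gt0.
- have : 12 * (K * B%:R) * beta k ^+ 2 <= 1.
    by rewrite -ler_pdivlMl ?mulr_gt0// mulr1 ltW.
  by rewrite addn0; lra.
- exact: error_sums.
- apply: bounded_sumsD; last first.
    by apply: bounded_sumsZ; [rewrite mulr_ge0 ?sqr_ge0|exact: alpha2_sums].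
  under [X in bounded_sums X]funext do rewrite mulrAC.
  apply: bounded_sumsZ; last exact: beta2_sums.
  by rewrite !mulr_ge0// ltW// (noise_gamma_gt0 hnoise).
Qed.

(** Three almost sure events, on which [pathwise_limit] applies: the descent terms
    are summable, the weighted disagreements are summable, and the distances to
    the points of a countable dense set of minimizers converge. *)
Theorem ae_cvg_argmin (i0 : 'I_n) :
  {ae P, forall w, exists2 p, argmin (wobjective r f) p &
    forall i, x t i w @[t --> \oo] --> p}.
Proof.
have [zs zsmin] := obj_argmin hobj.
have [rho rho0 rho_r] : exists2 rho, 0 < rho & forall i, rho <= r i 0.
  exists (rmin r); first by apply: lt_bigmin.
  by move=> i; exact: bigmin_le.
have [k [k1 bhalf bD]] := weighted_disag_sums i0 rho0 rho_r.
(* the disagreement is summable by now: any [s] will do *)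
pose s : R := 1; have s0 : 0 < s := ltr01.
have [Z [Zmin Zdense]] := countable_dense (obj_argmin hobj).
have b0 u : 0 < beta (k + u)%N.
  by have /andP[] := @beta_01 (k + u)%N (leq_trans k1 (leq_addr _ _)).
have k1u u : (1 <= k + u)%N by rewrite (leq_trans k1)// leq_addr.
pose err u := 2 * s * (beta (k + u)%N * \int[P]_w disag (X (k + u) w)) + error s (k + u).
have err_sums : bounded_sums err.
  apply: bounded_sumsD; last exact: error_sums.
  by apply: bounded_sumsZ => //; rewrite mulr_ge0// ltW.
pose des z u w := descent r s (alpha (k + u)%N) (beta (k + u)%N) L
  (X (k + u) w) (G (k + u) w) z.
have des0 z u w : argmin (wobjective r f) z -> 0 <= des z u w.
  by move=> zmin; exact: descent_ge0.
have drift u z A : argmin (wobjective r f) z -> <<s generators (k + u) >> A ->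
    \int[P]_(w in A) lyap r z (X (k + u).+1 w) + \int[P]_(w in A) des z u w <=
    \int[P]_(w in A) lyap r z (X (k + u) w) + err u.
  move=> zmin GA.
  have := @expected_drift rho s (k + u) z A i0 (k1u u) (bhalf u) rho0 rho_r s0 GA.
  have : 0 <= rho * eta / (2 * n%:R) * beta (k + u)%N *
      \int[P]_(w in A) edge_disag (E (k + u)) (X (k + u) w).
    apply: mulr_ge0; last by apply: Rintegral_ge0 => w _; exact: edge_disag_ge0.
    by rewrite mulr_ge0 ?(ltW (b0 u))// divr_ge0 ?mulr_ge0// ltW// (conn_eta_gt0 hconn).
  rewrite /err /des; lra.
have ae_des : {ae P, forall w, bounded_sums (des zs ^~ w)}.
  apply: ae_bounded_sums.
  - by move=> u w; exact: des0.
  - by move=> u; exact: descent_rint.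
  have [M hM] := err_sums.
  exists (\int[P]_w lyap r zs (X k w) + M) => N.
  suff : \int[P]_w lyap r zs (X (k + N) w) + \sum_(u < N) \int[P]_w des zs u w <=
      \int[P]_w lyap r zs (X k w) + \sum_(u < N) err u.
    have := hM N; have : 0 <= \int[P]_w lyap r zs (X (k + N) w).
      by apply: Rintegral_ge0 => w _; exact: lyap_ge0.
    lra.
  elim: N => [|N IH]; first by rewrite !big_ord0 addn0.
  rewrite !big_ord_recr /= addnS.
  have := @drift N zs setT zsmin (@measurableT _ (g_sigma_algebraType _)).
  lra.
have ae_dis : {ae P, forall w, bounded_sums (fun u => beta (k + u)%N * disag (X (k + u) w))}.
  apply: (@ae_bounded_sums _ _ _ P (fun u w => beta (k + u)%N * disag (X (k + u) w))).
  - by move=> u w; rewrite mulr_ge0 ?disag_ge0// ltW.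
  - by move=> u; apply: rintZ; exact: disag_rint.
  - rewrite [X in bounded_sums X](_ : _ = fun u =>
      beta (k + u)%N * \int[P]_w disag (X (k + u) w))//.
    by apply/funext => u; rewrite RintegralZl//; exact: disag_rint.
have ae_lyap : {ae P, forall w, forall q,
    exists l : R, lyap r (Z q) (X (k + t) w) @[t --> \oo] --> l}.
  apply: ae_forall_count => q.
  apply: (@almost_supermartingale_cvg _ _ _ P (fun t => generators (k + t)) _ _
    (fun t w => lyap r (Z q) (X (k + t) w)) err).
  - by move=> t; exact: generators_measurable.
  - by move=> t; rewrite addnS; exact: generatorsS.
  - by move=> t w; exact: lyap_ge0.
  - by move=> t; exact: lyap_adapted.
  - by move=> t; exact: lyap_rint.
  - move=> t A GA; have := drift t (Z q) A (Zmin q) GA.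
    have : 0 <= \int[P]_(w in A) des (Z q) t w.
      by apply: Rintegral_ge0 => w _; apply: des0.
    rewrite addnS; lra.
  - exact: err_sums.
apply: filterS3 ae_des ae_dis ae_lyap => w hdes hdis hlyap.
have [|p pmin hp] := @pathwise_limit _ _ _ r f g r_gt0 r_sum1 hg
  (fun t => X (k + t) w) (fun t => alpha (k + t)%N) (fun t => beta (k + t)%N) zs _ Z
  i0 zsmin (fun t => alpha_gt0 (k1u t)) b0 _ hdis (alpha2_beta_sums k1) (alpha_sums k1)
  Zdense hlyap.
  apply: le_bounded_sums hdes => t; rewrite /des.
  have := descent_ge r_ge0 r_sum1 (X (k + t) w) zs i0 s0 (alpha_gt0 (k1u t)) (b0 t) hg g_le.
  rewrite -/(G _ _) -[in X in X -> _]mulrA => h.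
  have : 0 <= alpha (k + t)%N * (wobjective r f (x (k + t)%N i0 w) - wobjective r f zs).
    by apply: mulr_ge0; [exact: ltW (alpha_gt0 (k1u t))|rewrite subr_ge0; exact: zsmin].
  by move: h; rewrite /X /G; lra.
exists p => // i; have := hp i; rewrite -(cvg_shiftn k (fun t => x t i w)) /=.
by under [X in X @ _ --> _ -> _]funext do rewrite addnC.
Qed.

End network_process.

(** * The limit as a random vector *)

(** An upper limit exists and is measurable whether or not the path converges. *)
Definition limit_vector (R : realType) (d : nat) (T : Type) (u : nat -> T -> 'rV[R]_d)
  (w : T) : 'rV[R]_d := \row_j fine (limn_esup (fun t => (u t w 0 j)%:E)).

Lemma limit_vector_random (R : realType) (d : nat) (disp : measure_display)
    (T : measurableType disp) (u : nat -> T -> 'rV[R]_d) :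
  (forall t, random_vector (u t)) -> random_vector (limit_vector u).
Proof.
move=> mu j; under [X in measurable_fun _ X]funext do rewrite mxE.
apply: (measurableT_comp (fine_measurable measurableT)).
apply: measurable_fun_limn_esup => t; apply/measurable_EFinP; exact: mu.
Qed.

Lemma limit_vectorE (R : realType) (d : nat) (T : Type) (u : nat -> T -> 'rV[R]_d)
    (w : T) (p : 'rV[R]_d) :
  u t w @[t --> \oo] --> p -> limit_vector u w = p.
Proof.
move=> /cvg_ballP up; apply/rowP => j; rewrite mxE.
have cj : (u t w 0 j)%:E @[t --> \oo] --> (p 0 j)%:E.
  apply: cvg_EFin; first exact: nearW.
  apply/cvgrPdist_lt => e e0.
  by apply: filterS (up _ e0) => t [_ /(_ 0 j)].
by rewrite is_cvg_limn_esupE ?(cvg_lim _ cj)//; apply/cvg_ex; exists (p 0 j)%:E.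
Qed.

Theorem theorem1 (R : realType) (disp : measure_display)
    (T : measurableType disp) (P : probability T R)
    (n d : nat) (hn : (2 <= n)%N) (hd : (1 <= d)%N)
    (r : 'cV[R]_n) (hr : stochastic_pos r)
    (E : nat -> {set 'I_n * 'I_n}) (W : nat -> 'M[R]_n)
    (hWE : forall t i j, (1 <= t)%N -> (0 < W t i j <-> (j, i) \in E t))
    (f : 'I_n -> 'rV[R]_d -> R)
    (g : 'I_n -> 'rV[R]_d -> 'rV[R]_d)
    (hg : forall i x, subgradient (f i) x (g i x))
    (alpha beta : nat -> R)
    (e x xhat : nat -> 'I_n -> T -> 'rV[R]_d)
    (he : forall t i, (1 <= t)%N -> random_vector (e t i))
    (hx : forall t i, (1 <= t)%N -> random_vector (x t i))
    (x1 : 'I_n -> 'rV[R]_d)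
    (hx1 : forall i w, x 1%N i w = x1 i)
    (hxhat : forall t i w, (1 <= t)%N ->
      xhat t i w = \sum_(j < n) W t i j *: x t j w + e t i w)
    (hdyn : forall t i w, (1 <= t)%N ->
      x t.+1 i w = (1 - beta t) *: x t i w + beta t *: xhat t i w
                   - alpha t *: g i (x t i w))
    (gamma : R)
    (hnoise : noise_assumption P
      (natural_filtration (fun t w => \matrix_(i < n) x t i w)) e gamma)
    (eta : R) (B : nat) (hconn : connectivity_assumption r E W eta B)
    (L : R) (hobj : objective_assumption r f L)
    (hstep : stepsize_assumption alpha beta (lambda r eta B)) :
  exists2 xt : T -> 'rV[R]_d, random_vector xt &
    {ae P, forall w, argmin (wobjective r f) (xt w) /\
      forall i : 'I_n, x t i w @[t --> \oo] --> xt w}.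
Proof.
have i0 : 'I_n by exact: Ordinal hn.
have [a_ni b_ni a0 b01 sa sa2 sb2 sab _] := hstep.
have shift := @bounded_sums_shift R 1.
have asum k : (1 <= k)%N -> ~ bounded_sums (fun t => alpha (k + t)%N).
  move=> k1 [M hM]; suff : (\sum_(1 <= t <oo) (alpha t)%:E <= (\sum_(1 <= t < k) alpha t + M)%:E)%E.
    by rewrite sa leye_eq.
  apply: lime_le.
    by apply: is_cvg_nneseries => t t1 _; rewrite lee_fin ltW// a0.
  exists k => // N /= kN; rewrite sumEFin lee_fin (@big_cat_nat _ _ _ k)//= lerD2l.
  rewrite -(subnKC kN) -{1}(add0n k) big_addn addKn big_mkord.
  by under eq_bigr do rewrite addnC.
have main := @ae_cvg_argmin R disp T P n d r E W f g alpha beta e x xhat x1 gamma eta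
  L B hr hWE hg he hx hx1 hxhat hdyn hnoise hconn hobj a0 b01 b_ni asum.
have {}main := main (shift _ (fun t t1 => sqr_ge0 _) sa2) (shift _ (fun t t1 => sqr_ge0 _) sb2).
have {}main := main (shift _ _ sab) i0.
(* from time 1 on: at time 0 the state is arbitrary, perhaps not measurable *)
exists (limit_vector (fun t => x t.+1 i0)).
  by apply: limit_vector_random => t; exact: hx.
have {}main : {ae P, forall w, exists2 p, argmin (wobjective r f) p &
    forall i, x t i w @[t --> \oo] --> p}.
  apply: main => t t1; apply: divr_ge0; first exact: sqr_ge0.
  by have /andP[/ltW] := b01 t t1.
apply: filterS main => w [p pmin hp].
rewrite (@limit_vectorE _ _ _ (fun t => x t.+1 i0) w p)//.
by have := hp i0; rewrite -(cvg_shiftS (fun t => x t i0 w)).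
Qed.
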